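(* Let $R$ be a ring which is coherent and such that every finitely presented $R$-module has finite projective dimension, and let $\mathcal{T}=D(R)$. Let $k$ be a field such that $\mathcal{T}$ is a $k$-linear triangulated category, and let $$F:\{\mathcal{T}^c\}^{op}\to\mathrm{mod}\text{-}k$$ be a $k$-linear exact functor which takes its values in the category $\mathrm{mod}\text{-}k$ of finite-dimensional $k$-vector spaces. Then $F$ is of the form $\mathbf{y}X$ (up to isomorphism) for some $X\in\mathcal{T}$.
   Context: Rings are associative with unit; modules are right unitary modules. A ring $R$ is coherent if the kernel of every map between finitely generated projective (right) $R$-modules is finitely presented. $\mathcal{T}=D(R)$ is the unbounded derived category of right $R$-modules, and $\mathcal{T}^c\subset\mathcal{T}$ is the full subcategory of compact objects, i.e. objects $c$ such that $\mathcal{T}(c,-)$ commutes with coproducts. That $\mathcal{T}$ is a $k$-linear triangulated category means its Hom groups are $k$-vector spaces with $k$-bilinear composition and the shift is $k$-linear (for example, when $R$ is a $k$-algebra). For $X\in\mathcal{T}$, $\mathbf{y}X=\mathcal{T}(-,X)|_{\mathcal{T}^c}$. A functor on $\{\mathcal{T}^c\}^{op}$ is exact (= homological) if it is additive and takes triangles to long exact sequences. *)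

(* Defs.v *)
From HB Require Import structures.
From mathcomp Require Import all_boot all_algebra.

Set Implicit Arguments.
Unset Strict Implicit.
Unset Printing Implicit Defensive.

Import GRing.Theory.
Local Open Scope ring_scope.

(* Right R-modules are left modules over the converse ring R^c. *)
Notation rmod R := (lmodType R^c).

Definition mklin (S : pzRingType) (U V : lmodType S) (f : U -> V)
    (fL : linear f) : {linear U -> V} :=
  HB.pack_for {linear U -> V} f (GRing.isLinear.Build S U V *:%R f fL).

Section Modules.
Variable R : pzRingType.
Implicit Types K M N P Q : rmod R.

Definition surj (A B : Type) (f : A -> B) := forall y, exists x, f x = y.

Definition exact_pair M N P (f : M -> N) (g : N -> P) :=
  forall y, g y = 0 <-> exists x, f x = y.

Definition fin_generated M :=
  exists n (g : {linear 'rV[R^c]_n -> M}), surj g.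

Definition fin_presented M :=
  exists m n (f : {linear 'rV[R^c]_m -> 'rV[R^c]_n})
    (g : {linear 'rV[R^c]_n -> M}), surj g /\ exact_pair f g.

Definition projective P :=
  forall M N (p : {linear M -> N}) (f : {linear P -> N}),
    surj p -> exists g : {linear P -> M}, forall x, p (g x) = f x.

Definition is_kernel K M N (i : {linear K -> M}) (f : {linear M -> N}) :=
  injective i /\ exact_pair i f.

Definition coherent :=
  forall P Q (f : {linear P -> Q}),
    projective P -> fin_generated P -> projective Q -> fin_generated Q ->
    exists K (i : {linear K -> P}), is_kernel i f /\ fin_presented K.

(* A resolution ... -> P 1 -> P 0 -> M -> 0 by projectives, zero beyond n. *)
Definition fin_proj_dim M :=
  exists (n : nat) (P : nat -> rmod R)
    (d : forall i, {linear P i.+1 -> P i}) (a : {linear P 0%N -> M}),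
  [/\ forall i, projective (P i),
      surj a /\ exact_pair (d 0%N) a,
      forall i, exact_pair (d i.+1) (d i) &
      forall i, (n < i)%N -> forall x : P i, x = 0].

End Modules.

(* Cochain complexes.  The differential takes a proof that its degrees are
   consecutive, so that degrees need only agree up to provable equality. *)
Record complex (R : pzRingType) := Complex {
  ob :> int -> rmod R;
  df : forall i j : int, i + 1 = j -> {linear ob i -> ob j};
  dfdf : forall (i j h : int) (eij : i + 1 = j) (ejh : j + 1 = h) x,
    df ejh (df eij x) = 0 }.
Arguments df {R} c {i j} _.

Record chain_map (R : pzRingType) (X Y : complex R) := ChainMap {
  cm :> forall i, {linear X i -> Y i};
  cmd : forall (i j : int) (e : i + 1 = j) x, cm j (df X e x) = df Y e (cm i x) }.

Section Complexes.
Variable R : pzRingType.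
Implicit Types X Y Z C : complex R.

Definition cm_to X Y (f : chain_map X Y) (i j : int) (e : i = j) : {linear X i -> Y j} :=
  match e in _ = j' return {linear X i -> Y j'} with erefl => f i end.

Lemma df_irr X (i j : int) (e e' : i + 1 = j) x : df X e x = df X e' x.
Proof. by rewrite (eq_irrelevance e e'). Qed.
Arguments df_irr {X i j} e e' x.

Definition cm_id X : chain_map X X :=
  @ChainMap R X X (fun i => idfun) (fun _ _ _ _ => erefl).

Lemma cm_comp_subproof X Y Z (g : chain_map Y Z) (f : chain_map X Y)
    (i j : int) (e : i + 1 = j) x : (g j \o f j) (df X e x) = df Z e ((g i \o f i) x).
Proof. by rewrite /= !cmd. Qed.

Definition cm_comp X Y Z (g : chain_map Y Z) (f : chain_map X Y) :
    chain_map X Z :=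
  @ChainMap R X Z (fun i => (g i \o f i : {linear _ -> _}))
    (@cm_comp_subproof X Y Z g f).

Lemma cm_zero_subproof X Y (i j : int) (e : i + 1 = j) (x : X i) :
  (\0 : {linear X j -> Y j}) (df X e x) =
  df Y e ((\0 : {linear X i -> Y i}) x).
Proof. by rewrite /= linear0. Qed.

Definition cm_zero X Y : chain_map X Y :=
  @ChainMap R X Y (fun i => (\0 : {linear X i -> Y i})) (@cm_zero_subproof X Y).

Definition cycle X i (x : X i) := forall j (e : i + 1 = j), df X e x = 0.

Definition boundary X i (x : X i) :=
  exists h (e : h + 1 = i) (y : X h), df X e y = x.

(* The map induced on each cohomology group is injective and surjective. *)
Definition quasi_iso X Y (f : chain_map X Y) :=
  forall i, (forall x : X i, cycle x -> boundary (f i x) -> boundary x) /\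
    (forall y : Y i, cycle y -> exists2 x : X i, cycle x & boundary (y - f i x)).

(** Shift: (X[n])^i = X^(i+n) with differential (-1)^n d *)

Lemma shift_deg (n i j : int) : i + 1 = j -> (i + n) + 1 = j + n.
Proof. by move=> <-; rewrite addrAC. Qed.

Definition sgn_by (n : int) (V : zmodType) (v : V) : V :=
  if odd `|n|%N then - v else v.

Lemma sgn_by_linear n X (i j : int) (e : i + 1 = j) :
  linear (fun x => sgn_by n (df X e x)).
Proof.
by move=> a u v; rewrite /sgn_by linearP; case: ifP => // _; rewrite opprD scalerN.
Qed.

Lemma shift_subproof n X (i j h : int) (eij : i + 1 = j) (ejh : j + 1 = h) x :
  mklin (@sgn_by_linear n X _ _ (shift_deg n ejh))
    (mklin (@sgn_by_linear n X _ _ (shift_deg n eij)) x) = 0.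
Proof. by rewrite /= /sgn_by; case: odd; rewrite ?linearN /= dfdf ?oppr0. Qed.

Definition shift n X : complex R :=
  @Complex R (fun i => X (i + n))
    (fun i j e => mklin (@sgn_by_linear n X _ _ (shift_deg n e)))
    (@shift_subproof n X).

Lemma cm_shift_subproof n X Y (f : chain_map X Y) (i j : int) (e : i + 1 = j)
    (x : shift n X i) :
  f (j + n) (df (shift n X) e x) = df (shift n Y) e (f (i + n) x).
Proof. by rewrite /= /sgn_by; case: odd; rewrite ?linearN /= cmd. Qed.

Definition cm_shift n X Y (f : chain_map X Y) :
    chain_map (shift n X) (shift n Y) :=
  @ChainMap R (shift n X) (shift n Y) (fun i => f (i + n))
    (@cm_shift_subproof n X Y f).

Lemma shift_cycle n X i (x : shift n X i) :
  @cycle (shift n X) i x <-> @cycle X (i + n) x.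
Proof.
split=> H j e.
  have e' : i + 1 = j - n by rewrite -e addrAC addrK.
  have {}e' : i + 1 = j - n := e'.
  have ej : j - n + n = j by rewrite subrK.
  move: (j - n) e' ej => l e' ej; case: _ / ej e => e.
  have := H l e'; rewrite /= /sgn_by (df_irr _ e).
  by case: ifP => // _ /eqP; rewrite oppr_eq0 => /eqP.
by rewrite /= /sgn_by H; case: ifP; rewrite ?oppr0.
Qed.

Lemma shift_boundary n X i (x : shift n X i) :
  @boundary (shift n X) i x <-> @boundary X (i + n) x.
Proof.
split=> [[h [e [y <-]]]|[h [e [y <-]]]].
  exists (h + n), (shift_deg n e); rewrite /= /sgn_by.
  by case: ifP => _; [exists (- y); rewrite linearN | exists y].
have ej : h - n + n = h by rewrite subrK.
have e' : h - n + 1 = i by rewrite addrAC e addrK.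
move: (h - n) e' ej => l e' ej; subst h.
exists l, e', (sgn_by n y); rewrite /= /sgn_by.
by case: odd; rewrite ?linearN ?opprK (df_irr _ e).
Qed.

Lemma quasi_iso_shift n X Y (f : chain_map X Y) :
  quasi_iso f -> quasi_iso (cm_shift n f).
Proof.
move=> qf i; have [fI fS] := qf (i + n); split=> [x cx bx|y cy].
  apply/(iffRL (@shift_boundary n X i x))/fI.
    exact: (iffLR (@shift_cycle n X i x) cx).
  exact: (iffLR (@shift_boundary n Y i _) bx).
have [x cx bx] := fS _ (iffLR (@shift_cycle n Y i y) cy).
exists x; first exact: (iffRL (@shift_cycle n X i x) cx).
exact: (iffRL (@shift_boundary n Y i (y - f (i + n) x)) bx).
Qed.

Lemma dsum_df_linear X Y (i j : int) (e : i + 1 = j) :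
  linear (fun p : (X i * Y i)%type => (df X e p.1, df Y e p.2)).
Proof. by move=> a u v; rewrite /= !linearP. Qed.

Lemma dsum_subproof X Y (i j h : int) (eij : i + 1 = j) (ejh : j + 1 = h) x :
  mklin (@dsum_df_linear X Y _ _ ejh) (mklin (@dsum_df_linear X Y _ _ eij) x) = 0.
Proof. by rewrite /= !dfdf. Qed.

Definition dsum X Y : complex R :=
  @Complex R (fun i => (X i * Y i)%type)
    (fun i j e => mklin (@dsum_df_linear X Y i j e)) (@dsum_subproof X Y).

Lemma cm_dsumr_linear X Y C (f : chain_map X Y) i :
  linear (fun p : (X i * C i)%type => (f i p.1, p.2)).
Proof. by move=> a u v; rewrite /= !linearP. Qed.

Lemma cm_dsumr_subproof X Y C (f : chain_map X Y) (i j : int) (e : i + 1 = j)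
    (x : dsum X C i) :
  mklin (@cm_dsumr_linear X Y C f j) (df (dsum X C) e x) =
  df (dsum Y C) e (mklin (@cm_dsumr_linear X Y C f i) x).
Proof. by rewrite /= cmd. Qed.

(* f (+) id_C *)
Definition cm_dsumr C X Y (f : chain_map X Y) :
    chain_map (dsum X C) (dsum Y C) :=
  @ChainMap R (dsum X C) (dsum Y C) (fun i => mklin (@cm_dsumr_linear X Y C f i))
    (@cm_dsumr_subproof X Y C f).

Lemma dsum_cycle X Y i (p : dsum X Y i) :
  cycle p <-> @cycle X i p.1 /\ @cycle Y i p.2.
Proof.
split=> [H|[H1 H2] j e]; last by rewrite /= H1 H2.
by split=> j e; have [] := H j e.
Qed.

Lemma dsum_boundary X Y i (p : dsum X Y i) :
  boundary p <-> @boundary X i p.1 /\ @boundary Y i p.2.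
Proof.
split=> [[h [e [y <-]]]|[[h [e [y Dy]]] [h' [e' [y' Dy']]]]].
  by split; exists h, e; [exists y.1 | exists y.2].
have E : h' = h by apply: (addIr 1); rewrite e e'.
case: _ / E e y Dy => e y Dy; exists h', e, (y, y').
by rewrite /= Dy (df_irr _ e') Dy'; case: (p).
Qed.

Lemma boundary0 X i : @boundary X i 0.
Proof.
have e : i - 1 + 1 = i by rewrite subrK.
by exists (i - 1), e, 0; rewrite linear0.
Qed.

Lemma quasi_iso_dsumr C X Y (f : chain_map X Y) :
  quasi_iso f -> quasi_iso (cm_dsumr C f).
Proof.
move=> qf i; have [fI fS] := qf i; split=> [x|y].
  move=> /dsum_cycle[c1 _] /dsum_boundary[b1 b2].
  by apply/dsum_boundary; split=> //; apply: fI.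
move=> /dsum_cycle[/fS[x cx bx] c2]; exists (x, y.2); first exact/dsum_cycle.
by apply/dsum_boundary; split=> //=; rewrite subrr; apply: boundary0.
Qed.

Lemma diag_linear X i : linear (fun x : X i => (x, x)).
Proof. by []. Qed.

Definition cm_diag X : chain_map X (dsum X X) :=
  @ChainMap R X (dsum X X) (fun i => mklin (@diag_linear X i))
    (fun _ _ _ _ => erefl).

Lemma codiag_linear X i : linear (fun p : (X i * X i)%type => p.1 + p.2).
Proof. by move=> a u v; rewrite /= scalerDr addrACA. Qed.

Lemma cm_codiag_subproof X (i j : int) (e : i + 1 = j) (x : dsum X X i) :
  mklin (@codiag_linear X j) (df (dsum X X) e x) =
  df X e (mklin (@codiag_linear X i) x).
Proof. by rewrite /= linearD. Qed.

Definition cm_codiag X : chain_map (dsum X X) X :=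
  @ChainMap R (dsum X X) X (fun i => mklin (@codiag_linear X i))
    (@cm_codiag_subproof X).

Lemma swap_linear X Y i :
  linear (fun p : (X i * Y i)%type => (p.2, p.1)).
Proof. by []. Qed.

Definition cm_swap X Y : chain_map (dsum X Y) (dsum Y X) :=
  @ChainMap R (dsum X Y) (dsum Y X) (fun i => mklin (@swap_linear X Y i))
    (fun _ _ _ _ => erefl).

(** Mapping cone: Cone(f)^i = X^(i+1) (+) Y^i, d(x, y) = (- dx, f x + dy) *)

Section Cone.
Variables (X Y : complex R) (f : chain_map X Y).

Lemma cone_df_linear (i j : int) (e : i + 1 = j) :
  linear (fun p : (shift 1 X i * Y i)%type =>
    (df (shift 1 X) e p.1, cm_to f e p.1 + df Y e p.2)).
Proof.
move=> a u v; congr (_, _); first exact: linearP.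
by rewrite /= !linearP scalerDr addrACA.
Qed.

Lemma cone_subproof (i j h : int) (eij : i + 1 = j) (ejh : j + 1 = h) x :
  mklin (cone_df_linear ejh) (mklin (cone_df_linear eij) x) = 0.
Proof.
case: _ / ejh; case: _ / eij => /=; rewrite /sgn_by /= linearN dfdf oppr0.
rewrite linearD dfdf addr0 oppr0 linearN cmd.
by rewrite (df_irr _ (erefl (i + 1 + 1))) addNr.
Qed.

Definition cone : complex R :=
  @Complex R (fun i => (shift 1 X i * Y i)%type)
    (fun i j e => mklin (cone_df_linear e)) cone_subproof.

Lemma cone_in_linear i : linear (fun y : Y i => (0 : shift 1 X i, y)).
Proof. by move=> a u v; rewrite [RHS]/GRing.add /= /add_pair /= scaler0 addr0. Qed.

Lemma cone_in_subproof (i j : int) (e : i + 1 = j) (y : Y i) :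
  mklin (@cone_in_linear j) (df Y e y) =
  df cone e (mklin (@cone_in_linear i) y).
Proof. by rewrite /= !linear0 add0r /sgn_by /= oppr0. Qed.

Definition cone_in : chain_map Y cone :=
  @ChainMap R Y cone (fun i => mklin (@cone_in_linear i)) cone_in_subproof.

Lemma cone_out_linear i : linear (fun p : (shift 1 X i * Y i)%type => p.1).
Proof. by []. Qed.

Definition cone_out : chain_map cone (shift 1 X) :=
  @ChainMap R cone (shift 1 X) (fun i => mklin (@cone_out_linear i))
    (fun _ _ _ _ => erefl).

End Cone.

(* The derived category D(R) is the (Gabriel-Zisman) localization of the
   category of complexes at the quasi-isomorphisms: its objects are complexes,
   and its morphisms are the formal composites [dhom] of chain maps and formal
   inverses of quasi-isomorphisms, taken up to the congruence [deq]. *)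
Inductive dhom : complex R -> complex R -> Type :=
| dmap X Y : chain_map X Y -> dhom X Y
| dinv X Y (s : chain_map X Y) : quasi_iso s -> dhom Y X
| dcomp X Y Z : dhom Y Z -> dhom X Y -> dhom X Z.

Notation "g \oD f" := (dcomp g f) (at level 50, left associativity).

Definition did X : dhom X X := dmap (cm_id X).

Reserved Notation "f =D g" (at level 70, no associativity).

Inductive deq : forall X Y, dhom X Y -> dhom X Y -> Prop :=
| deq_refl X Y (f : dhom X Y) : f =D f
| deq_sym X Y (f g : dhom X Y) : f =D g -> g =D f
| deq_trans X Y (f g h : dhom X Y) : f =D g -> g =D h -> f =D h
| deq_comp X Y Z (g g' : dhom Y Z) (f f' : dhom X Y) :
    g =D g' -> f =D f' -> g \oD f =D g' \oD f'
| deq_assoc X Y Z W (h : dhom Z W) (g : dhom Y Z) (f : dhom X Y) :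
    h \oD (g \oD f) =D (h \oD g) \oD f
| deq_idl X Y (f : dhom X Y) : did Y \oD f =D f
| deq_idr X Y (f : dhom X Y) : f \oD did X =D f
| deq_map X Y (f g : chain_map X Y) : (forall i, f i =1 g i) -> dmap f =D dmap g
| deq_map_comp X Y Z (g : chain_map Y Z) (f : chain_map X Y) :
    dmap (cm_comp g f) =D dmap g \oD dmap f
| deq_invl X Y (s : chain_map X Y) (qs : quasi_iso s) :
    dinv qs \oD dmap s =D did X
| deq_invr X Y (s : chain_map X Y) (qs : quasi_iso s) :
    dmap s \oD dinv qs =D did Y
where "f =D g" := (deq f g).

Definition diso X Y (f : dhom X Y) :=
  exists g : dhom Y X, g \oD f =D did X /\ f \oD g =D did Y.

Fixpoint dshift n X Y (f : dhom X Y) : dhom (shift n X) (shift n Y) :=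
  match f with
  | dmap _ _ u => dmap (cm_shift n u)
  | dinv _ _ _ qs => dinv (quasi_iso_shift n qs)
  | dcomp _ _ _ g h => dshift n g \oD dshift n h
  end.

(* The group structure of D(R)(X, Y): dzero is the image of the zero chain map,
   and f + g is the composite X -> X (+) X -> Y (+) Y -> Y of the diagonal,
   f (+) g and the codiagonal, f (+) g being obtained by acting successively
   on the two summands. *)
Definition dzero X Y : dhom X Y := dmap (cm_zero X Y).

Fixpoint ddsumr C X Y (f : dhom X Y) : dhom (dsum X C) (dsum Y C) :=
  match f with
  | dmap _ _ u => dmap (cm_dsumr C u)
  | dinv _ _ _ qs => dinv (quasi_iso_dsumr C qs)
  | dcomp _ _ _ g h => ddsumr C g \oD ddsumr C h
  end.

Definition dadd X Y (f g : dhom X Y) : dhom X Y :=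
  dmap (cm_codiag Y) \oD ddsumr Y f \oD dmap (cm_swap Y X) \oD ddsumr X g
    \oD dmap (cm_diag X).

(* Triangles isomorphic in D(R) to X -f-> Y -> Cone(f) -> X[1], f a chain map. *)
Definition distinguished A B C (u : dhom A B) (v : dhom B C)
    (w : dhom C (shift 1 A)) :=
  exists X Y (f : chain_map X Y)
    (a : dhom A X) (b : dhom B Y) (c : dhom C (cone f)),
  [/\ diso a, diso b & diso c] /\
  [/\ b \oD u =D dmap f \oD a,
      c \oD v =D dmap (cone_in f) \oD b &
      dshift 1 a \oD w =D dmap (cone_out f) \oD c].

Definition is_coproduct (I : eqType) (X : I -> complex R) S
    (inj : forall i, dhom (X i) S) :=
  forall Y (g : forall i, dhom (X i) Y),
    (exists h : dhom S Y, forall i, h \oD inj i =D g i) /\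
    (forall h h' : dhom S Y,
       (forall i, h \oD inj i =D h' \oD inj i) -> h =D h').

Definition dbigsum (I : eqType) X Y (s : seq I) (f : I -> dhom X Y) : dhom X Y :=
  foldr (fun i g => dadd (f i) g) (dzero X Y) s.

(* The canonical map (+)_i T(c, X i) -> T(c, S) is bijective for every coproduct
   S of a family X.  An element of the direct sum is given by a duplicate-free
   sequence s of indices and the components at these indices. *)
Definition compact c :=
  forall (I : eqType) (X : I -> complex R) S (inj : forall i, dhom (X i) S),
    is_coproduct inj ->
    (forall g : dhom c S, exists (s : seq I) (f : forall i, dhom c (X i)),
       uniq s /\ g =D dbigsum s (fun i => inj i \oD f i)) /\
    (forall (s : seq I) (f : forall i, dhom c (X i)), uniq s ->
       dbigsum s (fun i => inj i \oD f i) =D dzero c S ->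
       forall i, i \in s -> f i =D dzero c (X i)).

End Complexes.

Notation "g \oD f" := (dcomp g f) (at level 50, left associativity).
Notation "f =D g" := (deq f g) (at level 70, no associativity).

Record compact_object (R : pzRingType) := CompactObject {
  cval :> complex R;
  cvalP : compact cval }.
Arguments CompactObject {R cval} _.

(* A k-linear structure on the triangulated category D(R).  The vector space
   addition is the addition dadd of D(R), for which the axioms of abelian groups
   and biadditivity of composition hold, so only the scaling is data. *)
Record klinear (R : pzRingType) (k : fieldType) := KLinear {
  dscale : forall X Y : complex R, k -> dhom X Y -> dhom X Y;
  dscale_eq : forall X Y a (f g : dhom X Y), f =D g -> dscale a f =D dscale a g;
  dscaleA : forall X Y a b (f : dhom X Y),
    dscale a (dscale b f) =D dscale (a * b) f;
  dscale1 : forall X Y (f : dhom X Y), dscale 1 f =D f;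
  dscaleDr : forall X Y a (f g : dhom X Y),
    dscale a (dadd f g) =D dadd (dscale a f) (dscale a g);
  dscaleDl : forall X Y a b (f : dhom X Y),
    dscale (a + b) f =D dadd (dscale a f) (dscale b f);
  dscale_compl : forall X Y Z a (g : dhom Y Z) (f : dhom X Y),
    dscale a g \oD f =D dscale a (g \oD f);
  dscale_compr : forall X Y Z a (g : dhom Y Z) (f : dhom X Y),
    g \oD dscale a f =D dscale a (g \oD f);
  dscale_shift : forall X Y a (f : dhom X Y),
    dshift 1 (dscale a f) =D dscale a (dshift 1 f) }.

Section Functors.
Variables (R : pzRingType) (k : fieldType).

(* Functors from the opposite of the category of compact objects to mod-k. *)
Record cfunctor := CFunctor {
  fob :> compact_object R -> vectType k;
  fmap : forall c d : compact_object R, dhom c d -> 'Hom(fob d, fob c);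
  fmap_eq : forall (c d : compact_object R) (f g : dhom c d),
    f =D g -> fmap f = fmap g;
  fmap_id : forall c : compact_object R, fmap (did c) = \1%VF;
  fmap_comp : forall (c d e : compact_object R) (g : dhom d e) (f : dhom c d),
    fmap (g \oD f) = (fmap f \o fmap g)%VF }.
Arguments fmap F {c d} _ : rename.

Variables (L : klinear R k) (F : cfunctor).

Definition additive_functor :=
  forall (c d : compact_object R) (f g : dhom c d),
    fmap F (dadd f g) = fmap F f + fmap F g.

Definition klinear_functor := additive_functor /\
  forall (c d : compact_object R) a (f : dhom c d),
    fmap F (dscale L a f) = a *: fmap F f.

(* The segment F(B[1][n]) -> F(A[1][n]) -> F(C[n]) -> F(B[n]) -> F(A[n]) of the
   long exact sequence of a triangle A -> B -> C -> A[1]; n ranges over all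
   integers.  The compactness of the shifts, which follows from that of A, B
   and C, is only needed to make sense of the terms. *)
Definition exact_functor := additive_functor /\
  forall (A B C : compact_object R) (u : dhom A B) (v : dhom B C)
    (w : dhom C (shift 1 A)),
  distinguished u v w ->
  forall (n : int) (An : compact (shift n A)) (Bn : compact (shift n B))
    (Cn : compact (shift n C)) (A1n : compact (shift n (shift 1 A)))
    (B1n : compact (shift n (shift 1 B))),
  let Fu := @fmap F (CompactObject An) (CompactObject Bn) (dshift n u) in
  let Fv := @fmap F (CompactObject Bn) (CompactObject Cn) (dshift n v) in
  let Fw := @fmap F (CompactObject Cn) (CompactObject A1n) (dshift n w) in
  let Fu1 := @fmap F (CompactObject A1n) (CompactObject B1n)
               (dshift n (dshift 1 u)) in
  [/\ lker Fu = limg Fv, lker Fv = limg Fw & lker Fw = limg Fu1].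

(* A k-linear natural isomorphism from yX to F. *)
Definition iso_yoneda (X : complex R) :=
  exists eta : forall c : compact_object R, dhom c X -> F c,
  [/\ forall (c : compact_object R) (f g : dhom c X), f =D g <-> eta c f = eta c g,
      forall c : compact_object R, surj (eta c),
      forall (c : compact_object R) (f g : dhom c X),
        eta c (dadd f g) = eta c f + eta c g,
      forall (c : compact_object R) a (f : dhom c X),
        eta c (dscale L a f) = a *: eta c f &
      forall (c d : compact_object R) (h : dhom c d) (f : dhom d X),
        eta c (f \oD h) = fmap F h (eta d f)].

End Functors.

(* Main.v *)
(* D(R) satisfies Brown representability: for a contravariant functor
   whose elements glue over direct sums and extend over the cone of each map on
   which they vanish, a telescope of complexes obtained by attaching cells carries a
   universal element.  For the functor Hom(-, c) this yields a K-projective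
   resolution of c; maps in D(R) are then homotopy classes of chain maps, and
   the compact objects are the retracts of the complexes built from R in
   finitely many steps.

   As F takes finite-dimensional values and is exact, it is an injective object
   among the functors on perfect complexes: a compatible family of conditions
   F(f) y = w in a finite-dimensional space is solvable as soon as each of them
   is.  So the elements of Nat(Hom(-, Y), F) extend over cones, and the
   universal element given by Brown representability is an isomorphism from
   Hom(-, X) to F on perfect complexes, hence on their retracts. *)

Require Import Defs.
From HB Require Import structures.
From mathcomp Require Import all_boot all_algebra.
From mathcomp Require Import boolp.

Set Implicit Arguments.
Unset Strict Implicit.
Unset Printing Implicit Defensive.

Import GRing.Theory.
Local Open Scope ring_scope.

(** * Chain maps and homotopies *)

(** A morphism of D(R) is a formal word in chain maps and inverted quasi-isomorphisms, and no
    calculus of fractions is available to simplify it. Words are therefore evaluated: a word acts by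
    lifting on homotopy classes of maps out of a K-projective complex, and its action on one
    resolution of its source decides [=D]. Questions about D(R) thus become questions about chain
    maps up to homotopy. In the second use of Brown's construction the elements over Y are the
    transformations Hom(-, Y) -> F on perfect complexes, so a universal element over X is itself the
    comparison map Hom(-, X) -> F: the cells of the start make it surjective, the attached ones
    injective. The obstacle is the extension over a cone. A transformation vanishing along f : X ->
    Y descends only to the image of Hom(-, Y) in Hom(-, cone f), and it must be continued from this
    subfunctor, one map c -> cone f at a time, by Zorn's lemma. Each new value is subject to
    infinitely many linear conditions; exactness solves finitely many, and the descending chain
    condition on subspaces of F(c) does the rest. *)

Lemma linear_ext (S : pzRingType) (U V : lmodType S) (f g : {linear U -> V}) :
  f =1 g -> f = g.
Proof.
case: f => f [[f0] [fl]]; case: g => g [[g0] [gl]] /= /funext fg.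
case: _ / fg in g0 gl *.
by congr (GRing.Linear.Pack (GRing.Linear.Class _ _)); congr (_ _).
Qed.

(** Function extensionality and proof irrelevance make pointwise equal chain maps equal, so
    identities between composites can be used for rewriting and homotopy is the only relation left
    to manage. *)
Lemma chain_map_ext (R : pzRingType) (X Y : complex R) (f g : chain_map X Y) :
  (forall i, f i =1 g i) -> f = g.
Proof.
case: f => f fd; case: g => g gd /= fg.
have {}fg : f = g.
  by apply: functional_extensionality_dep => i; apply: linear_ext; exact: fg.
by case: _ / fg in gd *; congr ChainMap.
Qed.

Section ChainMapGroup.
Variables (R : pzRingType) (X Y : complex R).
Implicit Types f g : chain_map X Y.

HB.instance Definition _ := gen_eqMixin (chain_map X Y).
HB.instance Definition _ := gen_choiceMixin (chain_map X Y).

Lemma cm_add_subproof f g (i j : int) (e : i + 1 = j) x :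
  (f j \+ g j : {linear _ -> _}) (df X e x) =
  df Y e ((f i \+ g i : {linear _ -> _}) x).
Proof. by rewrite /= linearD !cmd. Qed.
Definition cm_add f g : chain_map X Y :=
  @ChainMap R X Y (fun i => f i \+ g i : {linear _ -> _}) (cm_add_subproof f g).

Lemma cm_opp_linear f i : linear (fun x => - f i x).
Proof. by move=> a u v; rewrite linearP opprD scalerN. Qed.

Lemma cm_opp_subproof f (i j : int) (e : i + 1 = j) x :
  mklin (@cm_opp_linear f j) (df X e x) = df Y e (mklin (@cm_opp_linear f i) x).
Proof. by rewrite /= linearN cmd. Qed.
Definition cm_opp f : chain_map X Y :=
  @ChainMap R X Y (fun i => mklin (@cm_opp_linear f i)) (cm_opp_subproof f).

Lemma cm_addA : associative cm_add.
Proof. by move=> f g h; apply: chain_map_ext => i x /=; rewrite addrA. Qed.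
Lemma cm_addC : commutative cm_add.
Proof. by move=> f g; apply: chain_map_ext => i x /=; rewrite addrC. Qed.
Lemma cm_add0 : left_id (cm_zero X Y) cm_add.
Proof. by move=> f; apply: chain_map_ext => i x /=; rewrite add0r. Qed.
Lemma cm_addN : left_inverse (cm_zero X Y) cm_opp cm_add.
Proof. by move=> f; apply: chain_map_ext => i x /=; rewrite addNr. Qed.
HB.instance Definition _ :=
  GRing.isZmodule.Build (chain_map X Y) cm_addA cm_addC cm_add0 cm_addN.

Lemma cmDE f g i x : (f + g) i x = f i x + g i x. Proof. by []. Qed.
Lemma cmNE f i x : (- f) i x = - f i x. Proof. by []. Qed.
Lemma cmBE f g i x : (f - g) i x = f i x - g i x. Proof. by []. Qed.
Lemma cm0E i x : (0 : chain_map X Y) i x = 0. Proof. by []. Qed.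

End ChainMapGroup.

Notation "g \oC f" := (cm_comp g f) (at level 40, left associativity).

Section Composition.
Variable R : pzRingType.
Implicit Types X Y Z W : complex R.

Lemma cm_compA X Y Z W (h : chain_map Z W) (g : chain_map Y Z) (f : chain_map X Y) :
  h \oC (g \oC f) = h \oC g \oC f.
Proof. exact: chain_map_ext. Qed.
Lemma cm_comp1l X Y (f : chain_map X Y) : cm_id Y \oC f = f.
Proof. exact: chain_map_ext. Qed.
Lemma cm_comp1r X Y (f : chain_map X Y) : f \oC cm_id X = f.
Proof. exact: chain_map_ext. Qed.
Lemma cm_compDl X Y Z (g h : chain_map Y Z) (f : chain_map X Y) :
  (g + h) \oC f = g \oC f + h \oC f.
Proof. exact: chain_map_ext. Qed.
Lemma cm_compBl X Y Z (g h : chain_map Y Z) (f : chain_map X Y) :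
  (g - h) \oC f = g \oC f - h \oC f.
Proof. exact: chain_map_ext. Qed.
Lemma cm_compDr X Y Z (f : chain_map Y Z) (g h : chain_map X Y) :
  f \oC (g + h) = f \oC g + f \oC h.
Proof. by apply: chain_map_ext => i x /=; rewrite linearD. Qed.
Lemma cm_compBr X Y Z (f : chain_map Y Z) (g h : chain_map X Y) :
  f \oC (g - h) = f \oC g - f \oC h.
Proof. by apply: chain_map_ext => i x /=; rewrite linearB. Qed.
Lemma cm_comp0l X Y Z (f : chain_map X Y) : (0 : chain_map Y Z) \oC f = 0.
Proof. exact: chain_map_ext. Qed.
Lemma cm_comp0r X Y Z (f : chain_map Y Z) : f \oC (0 : chain_map X Y) = 0.
Proof. by apply: chain_map_ext => i x /=; rewrite linear0. Qed.

(** Transport along an equality of degrees, needed because i + n - n and i are not convertible.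
    Equality proofs between integers are unique, so transports compose and cancel freely. *)
Definition cst X (i j : int) (e : i = j) : {linear X i -> X j} :=
  match e in _ = j' return {linear X i -> X j'} with erefl => idfun end.

Lemma cst_id X i (e : i = i) x : cst X e x = x.
Proof. by rewrite (eq_irrelevance e erefl). Qed.
Lemma cst_cst X i j h (e : i = j) (e' : j = h) x :
  cst X e' (cst X e x) = cst X (etrans e e') x.
Proof. by case: _ / e'. Qed.
Lemma cm_cst X Y (f : chain_map X Y) i j (e : i = j) x :
  f j (cst X e x) = cst Y e (f i x).
Proof. by case: _ / e. Qed.
Lemma cm_toE X Y (f : chain_map X Y) i j (e : i = j) x :
  cm_to f e x = cst Y e (f i x).
Proof. by case: _ / e. Qed.
Lemma df_cst X i j h (e : i = j) (e' : j + 1 = h) (e'' : i + 1 = h) x :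
  df X e' (cst X e x) = df X e'' x.
Proof. by case: _ / e e' => e' /=; rewrite (df_irr e' e''). Qed.
Lemma cst_df X i j h (e : j = h) (e' : i + 1 = j) (e'' : i + 1 = h) x :
  cst X e (df X e' x) = df X e'' x.
Proof. by case: _ / e e'' => e'' /=; rewrite (df_irr e' e''). Qed.

End Composition.

(** * Null-homotopies and their behaviour under shift *)

Section NullHomotopy.
Variable R : pzRingType.
Implicit Types X Y Z W : complex R.

(** Like the differential, the homotopy takes a proof that its degrees are consecutive, so f = dh +
    hd is stated without transports. *)
Definition nullh X Y (f : chain_map X Y) :=
  exists h : forall i j : int, j + 1 = i -> {linear X i -> Y j},
  forall i j l (eji : j + 1 = i) (eil : i + 1 = l) x,
    f i x = df Y eji (h i j eji x) + h l i eil (df X eil x).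

Lemma nullh0 X Y : nullh (0 : chain_map X Y).
Proof. by exists (fun _ _ _ => \0) => *; rewrite cm0E /= linear0 addr0. Qed.

Lemma nullhD X Y (f g : chain_map X Y) : nullh f -> nullh g -> nullh (f + g).
Proof.
move=> [h fh] [h' gh']; exists (fun i j e => h i j e \+ h' i j e : {linear _ -> _}).
by move=> i j l eji eil x; rewrite cmDE /= linearD addrACA -fh -gh'.
Qed.

Lemma nullhN X Y (f : chain_map X Y) : nullh f -> nullh (- f).
Proof.
move=> [h fh].
have hN i j (e : j + 1 = i) : linear (fun x => - h i j e x).
  by move=> a u v; rewrite linearP opprD scalerN.
exists (fun i j e => mklin (hN i j e)).
by move=> i j l eji eil x; rewrite cmNE /= linearN -opprD -fh.
Qed.

Lemma nullhB X Y (f g : chain_map X Y) : nullh f -> nullh g -> nullh (f - g).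
Proof. by move=> fh gh; apply/nullhD/nullhN. Qed.

Lemma nullhBB X Y (f : chain_map X Y) : nullh (f - f).
Proof. by rewrite subrr; apply: nullh0. Qed.

Lemma nullhBC X Y (f g : chain_map X Y) : nullh (f - g) -> nullh (g - f).
Proof. by move/nullhN; rewrite opprB. Qed.

Lemma nullhBT X Y (f g h : chain_map X Y) :
  nullh (f - g) -> nullh (g - h) -> nullh (f - h).
Proof. by move=> fg /(nullhD fg); rewrite addrA subrK. Qed.

Lemma nullh_eq X Y (f g : chain_map X Y) : nullh (f - g) -> nullh g -> nullh f.
Proof. by move=> fg /(nullhD fg); rewrite subrK. Qed.

Lemma nullh_compl X Y Z (g : chain_map Y Z) (f : chain_map X Y) :
  nullh f -> nullh (g \oC f).
Proof.
move=> [h fh]; exists (fun i j e => g j \o h i j e : {linear _ -> _}).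
by move=> i j l eji eil x; rewrite /= (fh _ _ _ eji eil) linearD cmd.
Qed.

Lemma nullh_compr X Y Z (g : chain_map Y Z) (f : chain_map X Y) :
  nullh g -> nullh (g \oC f).
Proof.
move=> [h gh]; exists (fun i j e => h i j e \o f i : {linear _ -> _}).
by move=> i j l eji eil x; rewrite /= (gh _ _ _ eji eil) cmd.
Qed.

Lemma sgn_byK n (V : zmodType) : involutive (@sgn_by n V).
Proof. by move=> v; rewrite /sgn_by; case: odd; rewrite ?opprK. Qed.

Lemma sgn_by_lin n (U V : zmodType) (f : {additive U -> V}) x :
  f (sgn_by n x) = sgn_by n (f x).
Proof. by rewrite /sgn_by; case: odd; rewrite ?raddfN. Qed.

(** The homotopy receives the same sign as the shifted differential, and in both terms dh and hd the
    two signs cancel. *)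
Lemma nullh_shift n X Y (f : chain_map X Y) : nullh f -> nullh (cm_shift n f).
Proof.
move=> [h fh].
have hL i j (e : j + 1 = i) :
    linear (fun x : shift n X i => sgn_by n (h _ _ (shift_deg n e) x)).
  by move=> a u v; rewrite /sgn_by linearP; case: odd; rewrite // opprD scalerN.
exists (fun i j e => mklin (hL i j e)) => i j l eji eil x /=.
by rewrite !sgn_by_lin !sgn_byK -fh.
Qed.

Lemma cm_shiftB n X Y (f g : chain_map X Y) :
  cm_shift n (f - g) = cm_shift n f - cm_shift n g.
Proof. exact: chain_map_ext. Qed.

Lemma cm_shift_comp n X Y Z (g : chain_map Y Z) (f : chain_map X Y) :
  cm_shift n (g \oC f) = cm_shift n g \oC cm_shift n f.
Proof. exact: chain_map_ext. Qed.

Lemma cm_shift_id n X : cm_shift n (cm_id X) = cm_id (shift n X).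
Proof. exact: chain_map_ext. Qed.

Section ShiftCancel.
Variables (n m : int) (nm : n + m = 0).

Lemma shift_deg0 (i : int) : i + n + m = i.
Proof. by rewrite -addrA nm addr0. Qed.

Lemma sgn_by_cancel (V : zmodType) (x : V) : sgn_by n (sgn_by m x) = x.
Proof.
have -> : n = - m by apply/eqP; rewrite -addr_eq0 nm.
by rewrite /sgn_by abszN; case: odd; rewrite ?opprK.
Qed.

Lemma unshift_subproof X (i j : int) (e : i + 1 = j) x :
  cst X (shift_deg0 j) (df (shift n (shift m X)) e x) =
  df X e (cst X (shift_deg0 i) x).
Proof.
rewrite /= sgn_by_cancel.
rewrite (df_cst _ _ (etrans (shift_deg m (shift_deg n e)) (shift_deg0 j))).
exact: cst_df.
Qed.
(** X[m][n] and X agree only up to transport of degrees. The differential carries no sign because n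
    and m = -n have the same parity. *)
Definition unshift X : chain_map (shift n (shift m X)) X :=
  @ChainMap R (shift n (shift m X)) X (fun i => cst X (shift_deg0 i))
    (@unshift_subproof X).

Lemma reshift_subproof X (i j : int) (e : i + 1 = j) x :
  cst X (esym (shift_deg0 j)) (df X e x) =
  df (shift n (shift m X)) e (cst X (esym (shift_deg0 i)) x).
Proof.
rewrite /= sgn_by_cancel (df_cst _ _ (etrans e (esym (shift_deg0 j)))).
exact: cst_df.
Qed.
Definition reshift X : chain_map X (shift n (shift m X)) :=
  @ChainMap R X (shift n (shift m X)) (fun i => cst X (esym (shift_deg0 i)))
    (@reshift_subproof X).

Lemma reshiftK X : unshift X \oC reshift X = cm_id X.
Proof. by apply: chain_map_ext => i x /=; rewrite cst_cst cst_id. Qed.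
Lemma unshiftK X : reshift X \oC unshift X = cm_id _.
Proof. by apply: chain_map_ext => i x /=; rewrite cst_cst cst_id. Qed.

Lemma unshift_nat X Y (f : chain_map X Y) :
  f \oC unshift X = unshift Y \oC cm_shift n (cm_shift m f).
Proof. by apply: chain_map_ext => i x /=; rewrite cm_cst. Qed.
Lemma reshift_nat X Y (f : chain_map X Y) :
  reshift Y \oC f = cm_shift n (cm_shift m f) \oC reshift X.
Proof. by apply: chain_map_ext => i x /=; rewrite cm_cst. Qed.

End ShiftCancel.

Lemma cst_shift n X i j (e : i = j) (e' : i + n = j + n) (x : X (i + n)) :
  cst (shift n X) e x = cst X e' x.
Proof. by case: _ / e e' => e'; rewrite !cst_id. Qed.

Lemma nullh_shift_inv n X Y (f : chain_map X Y) : nullh (cm_shift n f) -> nullh f.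
Proof.
move=> /(nullh_shift (- n)) H.
have E : f = unshift (addNr n) Y \oC cm_shift (- n) (cm_shift n f)
             \oC reshift (addNr n) X.
  by rewrite -unshift_nat -cm_compA reshiftK cm_comp1r.
by rewrite E; apply: nullh_compr; apply: nullh_compl.
Qed.

(** Adjunction between the shifts by n and -n. It reduces maps out of a shift to shifts of maps,
    which is how K-projectivity and compactness pass to shifts. *)
Lemma shift_transpose n X Y (g : chain_map (shift n X) Y) :
  exists f : chain_map X (shift (- n) Y),
    g = unshift (addrN n) Y \oC cm_shift n f.
Proof.
exists (cm_shift (- n) g \oC reshift (addNr n) X).
rewrite cm_shift_comp cm_compA -unshift_nat; apply: chain_map_ext => i x /=.
by rewrite (cst_shift _ (congr1 (+%R^~ n) (shift_deg0 (addrN n) i))) cst_cst cst_id.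
Qed.

End NullHomotopy.

#[local] Hint Resolve nullhBB : core.

(** * Mapping cones and fibers *)

Section ConeHomotopy.
Variable R : pzRingType.
Implicit Types X Y Z W C : complex R.

Lemma sgn_by1 (V : zmodType) (v : V) : sgn_by 1 v = - v.
Proof. by []. Qed.

(** The inclusion of X as the first summand of the cone is the homotopy. *)
Lemma nullh_cone_in X Y (f : chain_map X Y) : nullh (cone_in f \oC f).
Proof.
have hL i j (e : j + 1 = i) :
    linear (fun x : X i => (cst X (esym e) x, 0) : cone f j).
  move=> a u v; rewrite linearP.
  by congr (_, _); rewrite /= scaler0 addr0.
exists (fun i j e => mklin (hL i j e)) => i j l eji eil x /=.
rewrite sgn_by1 linear0 addr0 cm_toE cm_cst cst_cst cst_id.
rewrite (df_cst _ _ (erefl (i + 1))) (cst_df _ _ (erefl (i + 1))).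
rewrite /GRing.add /= /add_pair /=.
by rewrite addNr addr0.
Qed.

(** The projection of the cone to its second summand is the homotopy. *)
Lemma nullh_cone_out X Y (f : chain_map X Y) :
  nullh (cm_shift 1 f \oC cone_out f).
Proof.
have hL i j (e : j + 1 = i) :
    linear (fun p : cone f i => cst Y (esym e) p.2 : shift 1 Y j).
  by move=> a u v; rewrite linearP.
exists (fun i j e => mklin (hL i j e)) => i j l eji eil x /=.
rewrite sgn_by1 cm_toE linearD cst_cst cst_id.
rewrite (df_cst _ _ (erefl (i + 1))) (cst_df _ _ (erefl (i + 1))).
by rewrite addrCA addNr addr0.
Qed.

(** A null-homotopy of g f is exactly the missing component X[1] -> Z, and so the extension is
    strict and not merely up to homotopy. *)
Lemma cone_ext X Y Z (f : chain_map X Y) (g : chain_map Y Z) :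
  nullh (g \oC f) -> exists g' : chain_map (cone f) Z, g' \oC cone_in f = g.
Proof.
move=> [h gf].
have gL i : linear (fun p : cone f i => h (i + 1) i erefl p.1 + g i p.2).
  by move=> a u v; rewrite /= !linearP scalerDr addrACA.
have gd (i j : int) (e : i + 1 = j) (p : cone f i) :
    mklin (gL j) (df (cone f) e p) = df Z e (mklin (gL i) p).
  rewrite /= sgn_by1 cm_toE !linearD linearN cmd; case: _ / e => /=.
  have /= -> := gf _ _ _ (erefl (i + 1)) (erefl (i + 1 + 1)) p.1.
  have aux (V : zmodType) (a b c : V) : - a + (b + a + c) = b + c.
    by rewrite -addrA addrCA addKr.
  by rewrite (df_irr (shift_deg 1 (erefl (i + 1))) (erefl _)) aux.
exists (ChainMap gd); apply: chain_map_ext => i x /=.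
by rewrite linear0 add0r.
Qed.

Lemma addp (U V : zmodType) (p q : U * V) : p + q = (p.1 + q.1, p.2 + q.2).
Proof. by []. Qed.

Lemma scalep (S : pzRingType) (U V : lmodType S) a (p : U * V) :
  a *: p = (a *: p.1, a *: p.2).
Proof. by []. Qed.

(** Exactness of Hom(-, Z) at the cone. The restriction of g to the first summand is not a chain
    map; subtracting the homotopy composed with f repairs it. *)
Lemma cone_factor X Y Z (f : chain_map X Y) (g : chain_map (cone f) Z) :
  nullh (g \oC cone_in f) ->
  exists g' : chain_map (shift 1 X) Z, nullh (g - g' \oC cone_out f).
Proof.
move=> [h gf].
have gL i : linear (fun x : shift 1 X i =>
    g i (x, 0) - h (i + 1) i erefl (f (i + 1) x)).
  move=> a u v; rewrite !linearP scalerDr [RHS]addrACA; congr (_ + _).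
  by rewrite -linearP; congr (g i _); rewrite addp scalep /= scaler0 addr0.
have gd (i j : int) (e : i + 1 = j) (x : shift 1 X i) :
    mklin (gL j) (df (shift 1 X) e x) = df Z e (mklin (gL i) x).
  case: _ / e => /=; rewrite sgn_by1 [df Z _ _]linearB /= -[df Z _ (g _ _)]cmd /=.
  rewrite linear0 addr0 sgn_by1 !linearN opprK.
  set dx := df X _ x.
  have -> : (- dx, f (i + 1) x) = (- dx, 0) + (0, f (i + 1) x) :> cone f _.
    by rewrite addp /= addr0 add0r.
  have /= gE := gf _ _ _ (erefl (i + 1)) (erefl (i + 1 + 1)) (f (i + 1) x).
  rewrite linearD gE [df Z _ _ + _]addrC addrA addrK.
  by rewrite -cmd /dx (df_irr (shift_deg 1 (erefl (i + 1))) (erefl _)).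
exists (ChainMap gd).
have hL i j (e : j + 1 = i) : linear (fun p : cone f i => h i j e p.2).
  by move=> a u v; rewrite linearP.
exists (fun i j e => mklin (hL i j e)) => i j l eji eil [x y].
case: _ / eil; rewrite cmBE /=.
have -> : (x, y) = (x, 0) + (0, y) :> cone f i by rewrite addp /= addr0 add0r.
have /= gE := gf _ _ _ eji (erefl (i + 1)) y.
rewrite [g i (_ + _)]linearD gE [h _ i _ (_ + _)]linearD.
have aux (V : zmodType) (a b c d : V) : a + (c + d) - (a - b) = c + (b + d).
  by rewrite opprB addrC -addrA addKr addrCA.
exact: aux.
Qed.

Lemma predzK (i : int) : i - 1 + 1 = i.
Proof. exact: subrK. Qed.

(** Constructions below use the predecessor i - 1 with the proof [predzK], whereas a homotopy is
    tested at an arbitrary predecessor; the two data coincide. *)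
Lemma pred_irr (T : Type) (i : int) (F : forall j : int, j + 1 = i -> T) j j' e e' :
  F j e = F j' e'.
Proof.
have E : j' = j by apply: (addIr 1); rewrite e e'.
by case: _ / E e => e; rewrite (eq_irrelevance e e').
Qed.

(** Exactness of Hom(C, -) at the cone: the first component of u is a boundary of the homotopy h,
    and subtracting f h from the second component compensates for its removal. *)
Lemma cone_lift0 X Y C (f : chain_map X Y) (u : chain_map C (cone f)) :
  nullh (cone_out f \oC u) ->
  exists u' : chain_map C Y, nullh (u - cone_in f \oC u').
Proof.
move=> [h hu].
have uL i : linear (fun z : C i =>
    (u i z).2 - cm_to f (predzK i) (h i (i - 1) (predzK i) z)).
  by move=> a x y; rewrite !linearP scalerDr [RHS]addrACA.
have ud (i j : int) (e : i + 1 = j) (z : C i) :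
    mklin (uL j) (df C e z) = df Y e (mklin (uL i) z).
  case: _ / e => /=; rewrite cmd /= [df Y _ (_ - _)]linearB /=.
  rewrite (pred_irr (fun j e => cm_to f e (h _ j e (df C _ z))) _ erefl).
  have /= -> := hu _ _ _ (predzK i) (erefl (i + 1)) z.
  have aux (V : zmodType) (a b c : V) : - a + b + c - b = c - a.
    by rewrite addrAC addrK addrC.
  rewrite sgn_by1 [f _ (_ + _)]linearD [f _ (- _)]linearN aux cm_toE.
  by rewrite cmd (df_cst _ _ (shift_deg 1 (predzK i))).
exists (ChainMap ud).
have hL i j (e : j + 1 = i) : linear (fun z : C i => (h i j e z, 0) : cone f j).
  by move=> a x y; rewrite linearP addp scalep /= scaler0 addr0.
exists (fun i j e => mklin (hL i j e)) => i j l eji eil z; rewrite cmBE /=.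
have /= uE := hu _ _ _ eji eil z.
rewrite linear0 addr0 (pred_irr (fun j e => cm_to f e (h _ j e z)) _ eji).
by rewrite [u i z]surjective_pairing uE !addp /= subr0 addr0 subKr.
Qed.

(** A homotopy into the cone has two components: the first is the chain map into X, the second the
    homotopy between u and its composite with f. *)
Lemma cone_in_ker X Y C (f : chain_map X Y) (u : chain_map C Y) :
  nullh (cone_in f \oC u) ->
  exists u' : chain_map C X, nullh (u - f \oC u').
Proof.
move=> [h hu].
have uL i : linear (fun z : C i => cst X (predzK i) (h i (i - 1) (predzK i) z).1).
  by move=> a x y; rewrite linearP addp scalep /= linearP.
have ud (i j : int) (e : i + 1 = j) (z : C i) :
    mklin (uL j) (df C e z) = df X e (mklin (uL i) z).
  case: _ / e => /=.
  rewrite (pred_irr (fun j e => cst X e (h _ j e (df C _ z)).1) _ erefl).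
  have /= /(congr1 fst) /= := hu _ _ _ (predzK i) (erefl (i + 1)) z.
  rewrite (df_cst _ _ (shift_deg 1 (predzK i))) sgn_by1.
  by move/esym/(canRL (addNKr _)); rewrite addr0.
exists (ChainMap ud).
have hL i j (e : j + 1 = i) : linear (fun z : C i => (h i j e z).2).
  by move=> a x y; rewrite linearP addp scalep.
exists (fun i j e => mklin (hL i j e)) => i j l eji eil z; rewrite cmBE /=.
have /= /(congr1 snd) /= -> := hu _ _ _ eji eil z.
rewrite (pred_irr (fun j e => cst X e (h _ j e z).1) _ eji) cm_cst cm_toE.
by rewrite addrC -addrA addKr.
Qed.

(** The null-homotopy of f[1] w serves as the second component of the lift, which again is
    strict. *)
Lemma cone_lift X Y C (f : chain_map X Y) (w : chain_map C (shift 1 X)) :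
  nullh (cm_shift 1 f \oC w) ->
  exists u : chain_map C (cone f), cone_out f \oC u = w.
Proof.
move=> [h hw].
have uL i : linear (fun z : C i =>
    (w i z, cst Y (predzK i) (h i (i - 1) (predzK i) z)) : cone f i).
  by move=> a x y; rewrite !linearP.
have ud (i j : int) (e : i + 1 = j) (z : C i) :
    mklin (uL j) (df C e z) = df (cone f) e (mklin (uL i) z).
  case: _ / e => /=; congr (_, _); first exact: (cmd w).
  rewrite (pred_irr (fun j e => cst Y e (h _ j e (df C _ z))) _ erefl) /=.
  have /= -> := hw _ _ _ (predzK i) (erefl (i + 1)) z.
  by rewrite (df_cst _ _ (shift_deg 1 (predzK i))) sgn_by1 addrAC addNr add0r.
by exists (ChainMap ud); apply: chain_map_ext.
Qed.

Lemma nullh_reshift n m (nm : n + m = 0) X Y (g : chain_map _ Y) :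
  nullh (g \oC reshift nm X) -> nullh g.
Proof.
by move/(nullh_compr (unshift nm X)); rewrite -cm_compA unshiftK cm_comp1r.
Qed.

Lemma shift_transpose_cod n X Y (g : chain_map X (shift n Y)) :
  exists f : chain_map (shift (- n) X) Y,
    g = cm_shift n f \oC reshift (addrN n) X.
Proof.
exists (unshift (addNr n) Y \oC cm_shift (- n) g).
rewrite cm_shift_comp -cm_compA -reshift_nat; apply: chain_map_ext => i x /=.
rewrite (cst_shift _ (esym (congr1 (+%R^~ n) (shift_deg0 (addrN n) i)))).
by rewrite cst_cst cst_id.
Qed.

(** The homotopy fibre of f. *)
Definition fib X Y (f : chain_map X Y) := shift (-1) (cone f).

Definition fib_map X Y (f : chain_map X Y) : chain_map (fib f) X :=
  unshift (addNr 1) X \oC cm_shift (-1) (cone_out f).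

Lemma nullh_fib X Y (f : chain_map X Y) : nullh (f \oC fib_map f).
Proof.
rewrite /fib_map cm_compA unshift_nat -cm_compA -cm_shift_comp.
exact/nullh_compl/nullh_shift/nullh_cone_out.
Qed.

Lemma fib_lift X Y C (f : chain_map X Y) (w : chain_map C X) :
  nullh (f \oC w) -> exists w', fib_map f \oC w' = w.
Proof.
move/(nullh_shift 1); rewrite cm_shift_comp => /cone_lift[x xw].
exists (cm_shift (-1) x \oC reshift (addNr 1) C).
rewrite /fib_map cm_compA -[_ \oC _ \oC cm_shift _ x]cm_compA -cm_shift_comp xw.
by rewrite -unshift_nat -cm_compA reshiftK cm_comp1r.
Qed.

End ConeHomotopy.

(** * Direct sums *)

Section DirectSumModule.
Variables (R : pzRingType) (J : eqType) (M : J -> rmod R).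

(** The support is only asserted to exist; were a list of indices stored, equal components would not
    give equal elements. *)
Record dsm := Dsm {
  dfun :> forall j, M j;
  dsupp : exists s : seq J, forall j, j \notin s -> dfun j = 0 }.

HB.instance Definition _ := gen_eqMixin dsm.
HB.instance Definition _ := gen_choiceMixin dsm.

Lemma dsm_eq (x y : dsm) : (forall j, x j = y j) -> x = y.
Proof.
case: x y => x sx [y sy] /= xy.
have {}xy : x = y by apply: functional_extensionality_dep.
by case: _ / xy in sy *; congr Dsm.
Qed.

Lemma dsm0_subproof :
  exists s : seq J, forall j, j \notin s -> (0 : M j) = 0.
Proof. by exists [::]. Qed.
Definition dsm0 := Dsm dsm0_subproof.

Lemma dsmD_subproof (x y : dsm) :
  exists s : seq J, forall j, j \notin s -> x j + y j = 0.
Proof.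
have [s xs] := dsupp x; have [t yt] := dsupp y; exists (s ++ t) => j.
by rewrite mem_cat negb_or => /andP[/xs-> /yt->]; rewrite addr0.
Qed.
Definition dsmD x y := Dsm (dsmD_subproof x y).

Lemma dsmN_subproof (x : dsm) :
  exists s : seq J, forall j, j \notin s -> - x j = 0.
Proof. by have [s xs] := dsupp x; exists s => j /xs->; rewrite oppr0. Qed.
Definition dsmN x := Dsm (dsmN_subproof x).

Lemma dsmZ_subproof a (x : dsm) :
  exists s : seq J, forall j, j \notin s -> a *: x j = 0.
Proof. by have [s xs] := dsupp x; exists s => j /xs->; rewrite scaler0. Qed.
Definition dsmZ a x := Dsm (dsmZ_subproof a x).

Lemma dsmDA : associative dsmD.
Proof. by move=> x y z; apply: dsm_eq => j /=; rewrite addrA. Qed.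
Lemma dsmDC : commutative dsmD.
Proof. by move=> x y; apply: dsm_eq => j /=; rewrite addrC. Qed.
Lemma dsm0D : left_id dsm0 dsmD.
Proof. by move=> x; apply: dsm_eq => j /=; rewrite add0r. Qed.
Lemma dsmND : left_inverse dsm0 dsmN dsmD.
Proof. by move=> x; apply: dsm_eq => j /=; rewrite addNr. Qed.
HB.instance Definition _ := GRing.isZmodule.Build dsm dsmDA dsmDC dsm0D dsmND.

Lemma dsmZA a b x : dsmZ a (dsmZ b x) = dsmZ (a * b) x.
Proof. by apply: dsm_eq => j /=; rewrite scalerA. Qed.
Lemma dsm1Z : left_id 1 dsmZ.
Proof. by move=> x; apply: dsm_eq => j /=; rewrite scale1r. Qed.
Lemma dsmZDr : right_distributive dsmZ +%R.
Proof. by move=> a x y; apply: dsm_eq => j /=; rewrite scalerDr. Qed.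
Lemma dsmZDl x : {morph dsmZ^~ x : a b / a + b}.
Proof. by move=> a b; apply: dsm_eq => j /=; rewrite scalerDl. Qed.
HB.instance Definition _ :=
  GRing.Zmodule_isLmodule.Build R^c dsm dsmZA dsm1Z dsmZDr dsmZDl.

End DirectSumModule.

Section DirectSumMaps.
Variables (R : pzRingType) (J : eqType).
Implicit Types (M : J -> rmod R) (N : rmod R).

(** The value 0 at j' different from j makes this the j'-th component of the inclusion of [M j] into
    the direct sum. *)
Definition dcoerce M j j' (x : M j) : M j' :=
  if j =P j' is ReflectT e then eq_rect j M x j' e else 0.

Lemma dcoerce_id M j (x : M j) : dcoerce j x = x.
Proof. by rewrite /dcoerce; case: eqP => // e; rewrite (eq_irrelevance e erefl). Qed.

Lemma dcoerce_neq M j j' (x : M j) : j != j' -> dcoerce j' x = 0.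
Proof. by rewrite /dcoerce; case: eqP. Qed.

Lemma dproj_linear M j : linear (fun x : dsm M => x j).
Proof. by []. Qed.
Definition dproj M j : {linear dsm M -> M j} := mklin (@dproj_linear M j).

Lemma dinj_subproof M j (x : M j) :
  exists s : seq J, forall j', j' \notin s -> dcoerce j' x = 0.
Proof.
by exists [:: j] => j'; rewrite inE eq_sym => jj'; apply: dcoerce_neq.
Qed.

Lemma dinj_linear M j : linear (fun x : M j => Dsm (dinj_subproof x)).
Proof.
move=> a u v; apply: dsm_eq => j' /=; rewrite /dcoerce.
by case: eqP => [e|_]; [case: _ / e | rewrite scaler0 addr0].
Qed.
Definition dinj M j : {linear M j -> dsm M} := mklin (@dinj_linear M j).

Lemma dmap_subproof M M' (f : forall j, {linear M j -> M' j}) (x : dsm M) :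
  exists s : seq J, forall j, j \notin s -> f j (x j) = 0.
Proof. by have [s xs] := dsupp x; exists s => j /xs->; rewrite linear0. Qed.

Lemma dmap_linear M M' (f : forall j, {linear M j -> M' j}) :
  linear (fun x : dsm M => Dsm (dmap_subproof f x)).
Proof. by move=> a u v; apply: dsm_eq => j /=; rewrite linearP. Qed.
Definition dsm_map M M' (f : forall j, {linear M j -> M' j}) :
  {linear dsm M -> dsm M'} := mklin (dmap_linear f).

Lemma big_supp (N : zmodType) (f : J -> N) (s t : seq J) : uniq s -> uniq t ->
  (forall j, j \notin s -> f j = 0) -> (forall j, j \notin t -> f j = 0) ->
  \sum_(j <- s) f j = \sum_(j <- t) f j.
Proof.
move=> us ut fs ft; rewrite (bigID (mem t)) /= [X in _ + X]big1 // addr0.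
rewrite [RHS](bigID (mem s)) /= [X in _ = _ + X]big1 // addr0.
rewrite -big_filter -[RHS]big_filter; apply: perm_big; apply: uniq_perm.
- exact: filter_uniq.
- exact: filter_uniq.
- by move=> j; rewrite !mem_filter andbC.
Qed.

Section Case.
Variables (M : J -> rmod R) (N : rmod R) (g : forall j, {linear M j -> N}).

(** A support is chosen, without repetitions so that each component counts once; [dcaseE] shows
    independence of the choice. *)
Definition dcase_fun (x : dsm M) := \sum_(j <- undup (sval (cid (dsupp x)))) g j (x j).

Lemma dcaseE (x : dsm M) s : uniq s -> (forall j, j \notin s -> x j = 0) ->
  dcase_fun x = \sum_(j <- s) g j (x j).
Proof.
move=> us xs; rewrite /dcase_fun; case: cid => t /= xt.
apply: big_supp => //; first exact: undup_uniq.
  by move=> j; rewrite mem_undup => /xt ->; rewrite linear0.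
by move=> j /xs ->; rewrite linear0.
Qed.

Lemma dcase_linear : linear dcase_fun.
Proof.
move=> a u v; have [s us] := dsupp u; have [t vt] := dsupp v.
have su : forall j, j \notin undup (s ++ t) -> u j = 0.
  by move=> j; rewrite mem_undup mem_cat negb_or => /andP[/us].
have sv : forall j, j \notin undup (s ++ t) -> v j = 0.
  by move=> j; rewrite mem_undup mem_cat negb_or => /andP[_ /vt].
rewrite (dcaseE (undup_uniq _) su) (dcaseE (undup_uniq _) sv).
rewrite (@dcaseE _ (undup (s ++ t))) ?undup_uniq //.
  rewrite scaler_sumr -big_split; apply: eq_bigr => j _ /=.
  by rewrite linearP.
by move=> j jst /=; rewrite su // sv // scaler0 addr0.
Qed.
Definition dcase : {linear dsm M -> N} := mklin dcase_linear.

Lemma dcase_inj j x : dcase (dinj M j x) = g j x.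
Proof.
rewrite /= (@dcaseE _ [:: j]) // ?big_seq1 /= ?dcoerce_id //.
by move=> j'; rewrite inE eq_sym => jj' /=; apply: dcoerce_neq.
Qed.

End Case.

Lemma dsm_sum M (x : dsm M) s : uniq s -> (forall j, j \notin s -> x j = 0) ->
  x = \sum_(j <- s) dinj M j (x j).
Proof.
move=> us xs; apply: dsm_eq => j.
have -> : (\sum_(i <- s) dinj M i (x i)) j =
          \sum_(i <- s) dcoerce j (x i).
  by rewrite -[LHS]/(dproj M j _) linear_sum.
have [js|js] := boolP (j \in s); last first.
  rewrite xs // big1_seq // => i /andP[_ is_].
  by apply: dcoerce_neq; apply: contraNneq js => <-.
rewrite (big_rem j) //= dcoerce_id big1_seq ?addr0 // => i /andP[_].
by rewrite mem_rem_uniq // inE => /andP[ij _]; apply: dcoerce_neq.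
Qed.

Lemma dsm_ext M N (f g : {linear dsm M -> N}) :
  (forall j x, f (dinj M j x) = g (dinj M j x)) -> f =1 g.
Proof.
move=> fg x; have [s xs] := dsupp x.
rewrite (@dsm_sum _ x (undup s)) ?undup_uniq //; last first.
  by move=> j; rewrite mem_undup => /xs.
by rewrite !linear_sum; apply: eq_bigr => j _.
Qed.

End DirectSumMaps.

Section DirectSum.
Variables (R : pzRingType) (J : eqType) (X : J -> complex R).
Implicit Types (Y Z : complex R).

Lemma bsum_subproof (i i' h : int) (e : i + 1 = i') (e' : i' + 1 = h)
    (x : dsm (fun j => X j i)) :
  dsm_map (fun j => df (X j) e') (dsm_map (fun j => df (X j) e) x) = 0.
Proof. by apply: dsm_eq => j /=; rewrite dfdf. Qed.

Definition bsum : complex R :=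
  @Complex R (fun i => dsm (fun j => X j i))
    (fun i i' e => dsm_map (fun j => df (X j) e)) bsum_subproof.

Lemma binj_subproof j (i i' : int) (e : i + 1 = i') x :
  dinj (fun j => X j i') j (df (X j) e x) = df bsum e (dinj (fun j => X j i) j x).
Proof.
apply: dsm_eq => j' /=; rewrite /dcoerce.
by case: eqP => [e'|_]; [case: _ / e' | rewrite linear0].
Qed.
Definition binj j : chain_map (X j) bsum :=
  @ChainMap R (X j) bsum (fun i => dinj (fun j => X j i) j) (@binj_subproof j).

Definition bproj j : chain_map bsum (X j) :=
  @ChainMap R bsum (X j) (fun i => dproj (fun j => X j i) j)
    (fun i i' e x => erefl).

Lemma bprojK j : bproj j \oC binj j = cm_id (X j).
Proof. by apply: chain_map_ext => i x /=; rewrite dcoerce_id. Qed.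
Lemma bproj0 j j' : j != j' -> bproj j' \oC binj j = 0.
Proof. by move=> jj'; apply: chain_map_ext => i x /=; rewrite dcoerce_neq. Qed.

Lemma bcase_subproof Y (g : forall j, chain_map (X j) Y) (i i' : int)
    (e : i + 1 = i') x :
  dcase (fun j => g j i') (df bsum e x) = df Y e (dcase (fun j => g j i) x).
Proof.
apply: (@dsm_ext _ _ _ _ (dcase (fun j => g j i') \o df bsum e)
  (df Y e \o dcase (fun j => g j i))) => j y.
rewrite -[LHS]/(dcase _ (df bsum e (dinj (fun j => X j i) j y))).
rewrite -[RHS]/(df Y e (dcase _ (dinj (fun j => X j i) j y))).
by rewrite -binj_subproof !dcase_inj cmd.
Qed.
Definition bcase Y (g : forall j, chain_map (X j) Y) : chain_map bsum Y :=
  @ChainMap R bsum Y (fun i => dcase (fun j => g j i)) (bcase_subproof g).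

Lemma bcase_inj Y (g : forall j, chain_map (X j) Y) j :
  bcase g \oC binj j = g j.
Proof. by apply: chain_map_ext => i x; apply: dcase_inj. Qed.

Lemma bsum_ext Y (f g : chain_map bsum Y) :
  (forall j, f \oC binj j = g \oC binj j) -> f = g.
Proof.
move=> fg; apply: chain_map_ext => i; apply: dsm_ext => j x.
exact: (congr1 (fun u : chain_map (X j) Y => u i x) (fg j)).
Qed.

Lemma nullh_bsum Y (f : chain_map bsum Y) :
  (forall j, nullh (f \oC binj j)) -> nullh f.
Proof.
move=> H; pose h j := sval (cid (H j)); have hP j := svalP (cid (H j)).
exists (fun i i' e => dcase (fun j => h j i i' e)) => i i' l e e'.
apply: (@dsm_ext _ _ _ _ (f i) ((df Y e \o dcase (fun j => h j i i' e)) \+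
   (dcase (fun j => h j l i e') \o df bsum e'))) => j x.
rewrite -[f i _]/((f \oC binj j) i x) (hP j _ _ _ e e') -/(h j).
rewrite -[RHS]/(df Y e (dcase _ (dinj (fun j => X j i) j x)) +
  dcase _ (df bsum e' (dinj (fun j => X j i) j x))).
by rewrite -binj_subproof !dcase_inj.
Qed.

Lemma nullh_binj Y (f g : chain_map bsum Y) :
  (forall j, nullh (f \oC binj j - g \oC binj j)) -> nullh (f - g).
Proof. by move=> fg; apply: nullh_bsum => j; rewrite cm_compBl. Qed.

(** Projection to the finite subsum over s, kept as an endomorphism so that a map and its truncation
    can be subtracted. *)
Definition keep_mod (s : seq J) i : {linear bsum i -> bsum i} :=
  dsm_map (fun j => if j \in s then (idfun : {linear X j i -> X j i}) else \0).

Lemma keep_modE s i (x : bsum i) j : keep_mod s _ x j = if j \in s then x j else 0.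
Proof. by rewrite /=; case: ifP. Qed.

Lemma keep_subproof s (i i' : int) (e : i + 1 = i') x :
  keep_mod s _ (df bsum e x) = df bsum e (keep_mod s _ x).
Proof.
apply: dsm_eq => j; rewrite keep_modE.
rewrite -[RHS]/(df (X j) e (keep_mod s _ x j)) keep_modE.
by case: ifP; rewrite ?linear0.
Qed.
Definition keep s : chain_map bsum bsum := ChainMap (@keep_subproof s).

Lemma keepK s t : {subset s <= t} -> keep t \oC keep s = keep s.
Proof.
move=> st; apply: chain_map_ext => i x; apply: dsm_eq => j.
rewrite !keep_modE; case: ifP => // jt; case: ifP => // /st.
by rewrite jt.
Qed.

Lemma keep_sum s : uniq s -> keep s = \sum_(j <- s) binj j \oC bproj j.
Proof.
elim: s => [_|j s IHs /= /andP[js us]].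
  rewrite big_nil; apply: chain_map_ext => i x; apply: dsm_eq => j.
  by rewrite keep_modE.
rewrite big_cons -IHs //; apply: chain_map_ext => i x; apply: dsm_eq => j'.
rewrite cmDE keep_modE -[RHS]/(dcoerce j' (x j) + keep_mod s _ x j') keep_modE inE.
have [->|jj'] /= := eqVneq j' j; first by rewrite (negPf js) dcoerce_id addr0.
by rewrite dcoerce_neq ?add0r // eq_sym.
Qed.

Lemma keep_inj s j : j \in s -> keep s \oC binj j = binj j.
Proof.
move=> js; apply: chain_map_ext => i x; apply: dsm_eq => j'.
rewrite keep_modE; case: ifP => // j's /=; rewrite dcoerce_neq //.
by apply: contraTneq js => ->; rewrite j's.
Qed.

End DirectSum.

(** * Perfect complexes *)

Section Sphere.
Variable R : pzRingType.
Implicit Types X Y Z : complex R.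

Definition sphere_ob (i : int) : rmod R :=
  match i with Posz 0 => ((R^c)^o : rmod R) | _ => 'rV[R^c]_0 end.

(** R in degree 0. Maps out of it are 0-cycles and null-homotopic maps are boundaries, so it
    represents the cohomology in degree 0. *)
Definition sphere : complex R :=
  @Complex R sphere_ob (fun _ _ _ => \0) (fun _ _ _ _ _ _ => erefl).

Lemma scale_linear (V : rmod R) (x : V) : linear (fun v : (R^c)^o => (v : R^c) *: x).
Proof. by move=> a u v; rewrite scalerDl -scalerA. Qed.

Definition sphere_lin (V : int -> rmod R) (x : V 0) i : {linear sphere i -> V i} :=
  match i with Posz 0 => mklin (scale_linear x) | _ => \0 end.

Definition sphere1 : sphere 0 := (1 : R^c).

Lemma sphere_linE (V : int -> rmod R) (x : V 0) : sphere_lin x 0 sphere1 = x.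
Proof. exact: scale1r. Qed.

Lemma sphere_lin_ext (U : rmod R) i (f g : {linear sphere i -> U}) :
  (forall e : 0 = i, f (cst sphere e sphere1) = g (cst sphere e sphere1)) ->
  f =1 g.
Proof.
case: i f g => [[|n]|n] f g fg v.
- have -> : v = (v : R^c) *: sphere1 by rewrite /GRing.scale /= mulr1.
  by rewrite !linearZ; congr (_ *: _); apply: (fg erefl).
- by rewrite [v](thinmx0 (v : 'rV_0)) !linear0.
- by rewrite [v](thinmx0 (v : 'rV_0)) !linear0.
Qed.

Lemma sphere_map_subproof X (x : X 0) : Defs.cycle x ->
  forall (i j : int) (e : i + 1 = j) v,
  sphere_lin x _ (df sphere e v) = df X e (sphere_lin x _ v).
Proof.
move=> cx i j e; rewrite /= => v; rewrite linear0; symmetry.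
apply: (@sphere_lin_ext _ _ (df X e \o sphere_lin (V := X) x i) \0) => e0.
by case: _ / e0 e => e; rewrite /= scale1r cx.
Qed.

Definition sphere_map X (x : X 0) (cx : Defs.cycle x) : chain_map sphere X :=
  ChainMap (sphere_map_subproof cx).

Lemma sphere_mapE X (x : X 0) (cx : Defs.cycle x) : sphere_map cx 0 sphere1 = x.
Proof. exact: sphere_linE. Qed.

Lemma sphere_cycle X (f : chain_map sphere X) : Defs.cycle (f 0 sphere1).
Proof. by move=> j e; rewrite -cmd linear0. Qed.

Lemma sphere_ext X (f g : chain_map sphere X) :
  f 0 sphere1 = g 0 sphere1 -> f = g.
Proof.
move=> fg; apply: chain_map_ext => i; apply: sphere_lin_ext => e.
by case: _ / e.
Qed.

Lemma nullh_sphere X (f : chain_map sphere X) :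
  boundary (f 0 sphere1) -> nullh f.
Proof.
move=> [h [e [y yx]]].
have eh j (ej : j + 1 = 0) : h = j by apply: (addIr 1); rewrite e ej.
(* The homotopy is nonzero only out of degree 0, where it sends the generator to the primitive y,
   transported to the required degree. *)
pose H i j (ej : j + 1 = i) : {linear sphere i -> X j} :=
  (match i return (j + 1 = i -> {linear sphere i -> X j}) with
   | Posz 0 => fun ej => mklin (scale_linear (cst X (eh j ej) y))
   | _ => fun _ => \0 end) ej.
exists H => i j l ej el x; rewrite [df sphere _ _]/= linear0 addr0.
apply: (@sphere_lin_ext _ _ (f i) (df X ej \o H i j ej)) => e0.
case: _ / e0 ej el => ej el; rewrite /= scale1r (df_cst _ _ e).
by rewrite yx.
Qed.

Lemma boundary_sphere X (f : chain_map sphere X) :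
  nullh f -> boundary (f 0 sphere1).
Proof.
move=> [h fh]; exists (0 - 1), (predzK 0), (h _ _ (predzK 0) sphere1).
by rewrite (fh _ _ _ (predzK 0) (erefl (0 + 1))) [df sphere _ _]/= linear0 addr0.
Qed.

End Sphere.

Section BinarySum.
Variable R : pzRingType.
Implicit Types X Y Z : complex R.

Lemma cm_inl_linear X Y i : linear (fun x : X i => (x, 0 : Y i)).
Proof. by move=> a u v; rewrite addp scalep /= scaler0 addr0. Qed.
Lemma cm_inl_subproof X Y (i j : int) (e : i + 1 = j) x :
  mklin (@cm_inl_linear X Y j) (df X e x) =
  df (dsum X Y) e (mklin (@cm_inl_linear X Y i) x).
Proof. by rewrite /= linear0. Qed.
Definition cm_inl X Y : chain_map X (dsum X Y) := 
  @ChainMap R X (dsum X Y) (fun i => mklin (@cm_inl_linear X Y i))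
    (@cm_inl_subproof X Y).

Definition cm_inr X Y : chain_map Y (dsum X Y) := cm_swap Y X \oC cm_inl Y X.

Lemma cm_fst_linear X Y i : linear (fun p : dsum X Y i => p.1).
Proof. by []. Qed.
Definition cm_fst X Y : chain_map (dsum X Y) X :=
  @ChainMap R (dsum X Y) X (fun i => mklin (@cm_fst_linear X Y i))
    (fun _ _ _ _ => erefl).

Definition cm_snd X Y : chain_map (dsum X Y) Y := cm_fst Y X \oC cm_swap X Y.

Lemma cm_inlK X Y : cm_fst X Y \oC cm_inl X Y = cm_id X.
Proof. exact: chain_map_ext. Qed.
Lemma cm_inrK X Y : cm_snd X Y \oC cm_inr X Y = cm_id Y.
Proof. exact: chain_map_ext. Qed.
Lemma cm_fst_inr X Y : cm_fst X Y \oC cm_inr X Y = 0.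
Proof. exact: chain_map_ext. Qed.
Lemma cm_snd_inl X Y : cm_snd X Y \oC cm_inl X Y = 0.
Proof. exact: chain_map_ext. Qed.

Lemma dsum_split X Y Z (g : chain_map (dsum X Y) Z) :
  g = g \oC cm_inl X Y \oC cm_fst X Y + g \oC cm_inr X Y \oC cm_snd X Y.
Proof.
apply: chain_map_ext => i [x y]; rewrite cmDE /= -linearD addp /=.
by rewrite addr0 add0r.
Qed.

End BinarySum.

(** * K-projective complexes *)

Section Kproj.
Variable R : pzRingType.
Implicit Types P X Y Z N : complex R.

Definition acyclic N := forall i (x : N i), Defs.cycle x -> boundary x.

Definition kproj P := forall N, acyclic N -> forall g : chain_map P N, nullh g.

Lemma acyclic_shift n N : acyclic N -> acyclic (shift n N).
Proof. by move=> aN i x /shift_cycle /aN /shift_boundary. Qed.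

Lemma kproj_sphere : kproj (sphere R).
Proof. by move=> N aN g; apply/nullh_sphere/aN/sphere_cycle. Qed.

Lemma kproj_shift n P : kproj P -> kproj (shift n P).
Proof.
move=> kP N aN g; have [f ->] := shift_transpose g.
by apply/nullh_compl/nullh_shift/kP/acyclic_shift.
Qed.

Lemma kproj_dsum X Y : kproj X -> kproj Y -> kproj (dsum X Y).
Proof.
move=> kX kY N aN g; rewrite [g]dsum_split.
by apply: nullhD; apply: nullh_compr; [apply: kX | apply: kY].
Qed.

Lemma kproj_bsum (J : eqType) (X : J -> complex R) :
  (forall j, kproj (X j)) -> kproj (bsum X).
Proof. by move=> kX N aN g; apply: nullh_bsum => j; apply: kX. Qed.

Lemma kproj_cone X Y (f : chain_map X Y) : kproj X -> kproj Y -> kproj (cone f).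
Proof.
move=> kX kY N aN g; have [g' gg'] := cone_factor (kY _ aN (g \oC cone_in f)).
by apply: (nullh_eq gg'); apply/nullh_compr/(kproj_shift kX).
Qed.

End Kproj.

(** * Compactness in the homotopy category *)

Section HomotopyCompact.
Variable R : pzRingType.
Implicit Types c X Y Z : complex R.

(** Up to homotopy every map into a direct sum lands in a finite subsum. *)
Definition hcompact c :=
  forall (J : eqType) (X : J -> complex R) (g : chain_map c (bsum X)),
  exists s : seq J, nullh (keep X s \oC g - g).

Lemma keep_mono c (J : eqType) (X : J -> complex R) (g : chain_map c (bsum X)) s t :
  {subset s <= t} -> nullh (keep X s \oC g - g) -> nullh (keep X t \oC g - g).
Proof.
move=> st gs; apply: nullhBT (gs).
have := nullh_compl (keep X t) (nullhBC gs).
by rewrite cm_compBr cm_compA keepK.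
Qed.

Lemma hcompact_sphere : hcompact (sphere R).
Proof.
move=> J X g; have [s sg] := dsupp (g 0 (sphere1 R)); exists s.
have -> : keep X s \oC g = g; last by apply: nullhBB.
apply: sphere_ext; apply: dsm_eq => j; rewrite [LHS]keep_modE.
by case: ifPn => // /sg.
Qed.

Lemma sgn_dsm n (J : eqType) (M : J -> rmod R) (x : dsm M) j :
  (sgn_by n x) j = sgn_by n (x j).
Proof. by rewrite /sgn_by; case: odd. Qed.

Lemma bsum_shift_subproof n (J : eqType) (X : J -> complex R)
    (i j : int) (e : i + 1 = j) (x : shift n (bsum X) i) :
  (idfun : {linear shift n (bsum X) j -> bsum (fun a => shift n (X a)) j})
    (df (shift n (bsum X)) e x) = df (bsum (fun a => shift n (X a))) e x.
Proof. by apply: dsm_eq => a; rewrite /= sgn_dsm. Qed.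

Definition bsum_shift n (J : eqType) (X : J -> complex R) :
    chain_map (shift n (bsum X)) (bsum (fun a => shift n (X a))) :=
  @ChainMap R (shift n (bsum X)) (bsum (fun a => shift n (X a)))
    (fun i => idfun) (@bsum_shift_subproof n J X).

Definition shift_bsum n (J : eqType) (X : J -> complex R) :
    chain_map (bsum (fun a => shift n (X a))) (shift n (bsum X)) :=
  @ChainMap R (bsum (fun a => shift n (X a))) (shift n (bsum X))
    (fun i => idfun) (fun i j e x => esym (bsum_shift_subproof e x)).

Lemma shift_bsumK n (J : eqType) (X : J -> complex R) :
  shift_bsum n X \oC bsum_shift n X = cm_id _.
Proof. exact: chain_map_ext. Qed.

Lemma keep_shift n (J : eqType) (X : J -> complex R) s :
  keep (fun a => shift n (X a)) s \oC bsum_shift n X =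
  bsum_shift n X \oC cm_shift n (keep X s).
Proof. by apply: chain_map_ext => i x; apply: dsm_eq => a; rewrite !keep_modE. Qed.

Lemma hcompact_shift n c : hcompact c -> hcompact (shift n c).
Proof.
move=> hc J X g; have [f gE] := shift_transpose g.
have [s fs] := hc _ _ (bsum_shift (- n) X \oC f); exists s.
move/(nullh_compl (shift_bsum (- n) X)): fs.
rewrite cm_compBr !cm_compA -[_ \oC keep _ _ \oC _]cm_compA keep_shift.
rewrite cm_compA shift_bsumK !cm_comp1l => /(nullh_shift n).
move/(nullh_compl (unshift (addrN n) (bsum X))).
by rewrite cm_shiftB cm_compBr -gE cm_shift_comp cm_compA -unshift_nat -cm_compA -gE.
Qed.

Lemma hcompact_dsum X Y : hcompact X -> hcompact Y -> hcompact (dsum X Y).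
Proof.
move=> hX hY J Z g.
have [s gs] := hX _ _ (g \oC cm_inl X Y); have [t gt] := hY _ _ (g \oC cm_inr X Y).
exists (s ++ t); rewrite [_ - g]dsum_split !cm_compBl -!cm_compBl.
apply: nullhD; apply: nullh_compr; rewrite cm_compBl -cm_compA.
  by apply: keep_mono gs => j js; rewrite mem_cat js.
by apply: keep_mono gt => j jt; rewrite mem_cat jt orbT.
Qed.

Lemma hcompact_cone X Y (f : chain_map X Y) :
  hcompact X -> hcompact Y -> hcompact (cone f).
Proof.
move=> hX hY J Z g; have [s gs] := hY _ _ (g \oC cone_in f).
rewrite cm_compA -cm_compBl in gs; have [u gu] := cone_factor gs.
have [t ut] := hcompact_shift hX u; exists (s ++ t).
have st : {subset s <= s ++ t} by move=> j js; rewrite mem_cat js.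
have ts : {subset t <= s ++ t} by move=> j js; rewrite mem_cat js orbT.
have {}ut := nullh_compr (cone_out f) (keep_mono ts ut).
rewrite cm_compBl -cm_compA in ut.
have {gu ut} := nullhD gu (nullhBC ut); rewrite addrA subrK => gu.
(* Write K for the projection to the union and D for [keep Z s \oC g - g]. Now D is homotopic to K u
   followed after [cone_out], a map that K fixes, hence D to K D. As K fixes [keep Z s], comparing
   the two gives that g is homotopic to K g. *)
have := nullhB gu (nullh_compl (keep Z (s ++ t)) gu).
rewrite !cm_compBr ![keep Z (s ++ t) \oC (keep _ _ \oC _)]cm_compA !keepK //.
by rewrite opprB addrA subrK opprB addrC addrA subrK.
Qed.

End HomotopyCompact.

(** * Complexes built from R, and factorization through perfect ones *)

Section Perfect.
Variable R : pzRingType.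
Implicit Types p q c X Y Z W : complex R.

(* Perfect complexes are named by codes, not given by an inductive predicate,
   because they must be indexed by a small type: the construction of X takes
   direct sums over all of them. *)
Fixpoint code (n : nat) : {C : Type & C -> complex R} :=
  match n with
  | 0 => @existT Type (fun C => C -> complex R) unit (fun _ => sphere R)
  | n.+1 =>
    let: existT C E := code n in
    @existT Type (fun C => C -> complex R)
      (C + (int * C + (C * C + {st : C * C & chain_map (E st.1) (E st.2)})))%type
      (fun x => match x with
        | inl c => E c
        | inr (inl (m, c)) => shift m (E c)
        | inr (inr (inl (c, d))) => dsum (E c) (E d)
        | inr (inr (inr (existT st f))) => cone f
        end)
  end.

Definition pcode := {n : nat & projT1 (code n)}.
Definition pcx (t : pcode) : complex R := projT2 (code (projT1 t)) (projT2 t).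
Definition perf p := exists t : pcode, pcx t = p.

(** Levels are cumulative, so two perfect complexes have codes at a common level, where their sum
    and the cones of maps between them can be named. *)
Lemma code_lift n m (t : projT1 (code n)) : (n <= m)%N ->
  exists t' : projT1 (code m), projT2 (code m) t' = projT2 (code n) t.
Proof.
elim: m => [|m IHm]; first by case: n t => // t _; exists t.
rewrite leq_eqVlt => /predU1P[nm|/IHm[t' <-]].
  by case: _ / nm; exists t.
by rewrite /=; case: (code m) t' => C E t' /=; exists (inl t').
Qed.

Lemma perf_code p : perf p -> exists n, forall m, (n <= m)%N ->
  exists t : projT1 (code m), projT2 (code m) t = p.
Proof.
case=> -[n t] <-; exists n => m nm; have [u ut] := code_lift t nm.
by exists u; rewrite ut.
Qed.

Lemma perf_step p n : (exists t : projT1 (code n), projT2 (code n) t = p) -> perf p.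
Proof. by case=> t <-; exists (existT _ n t). Qed.

Lemma perf_sphere : perf (sphere R).
Proof. by apply: (@perf_step _ 0); exists tt. Qed.

Lemma perf_shift n p : perf p -> perf (shift n p).
Proof.
case=> -[m t] <-; apply: (@perf_step _ m.+1); rewrite /pcx /=.
by case: (code m) t => C E t /=; exists (inr (inl (n, t))).
Qed.

Lemma perf_pair p q : perf p -> perf q ->
  exists n (s t : projT1 (code n)), projT2 (code n) s = p /\ projT2 (code n) t = q.
Proof.
move=> /perf_code[n pn] /perf_code[m qm]; exists (maxn n m).
have [s <-] := pn _ (leq_maxl n m); have [t <-] := qm _ (leq_maxr n m).
by exists s, t.
Qed.

Lemma perf_dsum p q : perf p -> perf q -> perf (dsum p q).
Proof.
move=> /perf_pair/[apply] -[n [s [t [<- <-]]]]; apply: (@perf_step _ n.+1).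
by move: s t; rewrite /=; case: (code n) => C E /= s t; exists (inr (inr (inl (s, t)))).
Qed.

Lemma perf_cone p q (f : chain_map p q) : perf p -> perf q -> perf (cone f).
Proof.
move=> /perf_pair/[apply] -[n [s [t [sp tq]]]].
move: f; case: _ / sp; case: _ / tq => f; apply: (@perf_step _ n.+1).
move: s t f; rewrite /=; case: (code n) => C E /= s t f.
by exists (inr (inr (inr (existT _ (s, t) f)))).
Qed.

Lemma perf_fib p q (f : chain_map p q) : perf p -> perf q -> perf (fib f).
Proof. by move=> pp pq; apply/perf_shift/perf_cone. Qed.

Lemma perf_ind (P : complex R -> Prop) :
  P (sphere R) -> (forall n p, P p -> P (shift n p)) ->
  (forall p q, P p -> P q -> P (dsum p q)) ->
  (forall p q (f : chain_map p q), P p -> P q -> P (cone f)) ->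
  forall p, perf p -> P p.
Proof.
move=> P0 Psh Psum Pcone p [[n t] <-]; rewrite /pcx /=.
elim: n t => [//|n IHn]; rewrite /=; case: (code n) IHn => C E /= IHn.
case=> [c //|[[m c]|[[c d]|[st f]]]]; first exact: Psh.
  exact: Psum.
exact: Pcone.
Qed.

Lemma perf_kproj p : perf p -> kproj p.
Proof.
elim/perf_ind=> [|n q|q q'|q q' f]; [exact: kproj_sphere | exact: kproj_shift |
  exact: kproj_dsum | exact: kproj_cone].
Qed.

Lemma perf_hcompact p : perf p -> hcompact p.
Proof.
elim/perf_ind=> [|n q|q q'|q q' f]; [exact: hcompact_sphere | exact: hcompact_shift |
  exact: hcompact_dsum | exact: hcompact_cone].
Qed.

Definition factors c W (g : chain_map c W) := exists p, perf p /\
  exists (a : chain_map c p) (b : chain_map p W), nullh (g - b \oC a).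

Lemma factors_eq c W (g g' : chain_map c W) : nullh (g - g') -> factors g' -> factors g.
Proof.
by move=> gg' [p [pp [a [b gE]]]]; exists p; split=> //; exists a, b; apply: nullhBT gE.
Qed.

Lemma factors0 c W : factors (0 : chain_map c W).
Proof.
exists (sphere R); split; first exact: perf_sphere.
by exists 0, 0; rewrite cm_comp0l subrr; apply: nullh0.
Qed.

Lemma factorsD c W (g h : chain_map c W) : factors g -> factors h -> factors (g + h).
Proof.
move=> [p [pp [a [b gE]]]] [q [pq [a' [b' hE]]]].
exists (dsum p q); split; first exact: perf_dsum.
exists (cm_inl p q \oC a + cm_inr p q \oC a').
exists (b \oC cm_fst p q + b' \oC cm_snd p q).
have -> : g + h - (b \oC cm_fst p q + b' \oC cm_snd p q) \oC
  (cm_inl p q \oC a + cm_inr p q \oC a') = g - b \oC a + (h - b' \oC a').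
  rewrite [RHS]addrACA -opprD; congr (_ - _).
  apply: chain_map_ext => i x.
  by rewrite cmDE /= addr0 add0r.
exact: nullhD.
Qed.

Lemma factors_compr c c' W (g : chain_map c W) (a : chain_map c' c) :
  factors g -> factors (g \oC a).
Proof.
move=> [p [pp [a' [b gE]]]]; exists p; split=> //; exists (a' \oC a), b.
by rewrite cm_compA -cm_compBl; apply: nullh_compr.
Qed.

Lemma factors_compl c W W' (g : chain_map c W) (a : chain_map W W') :
  factors g -> factors (a \oC g).
Proof.
move=> [p [pp [a' [b gE]]]]; exists p; split=> //; exists a', (a \oC b).
by rewrite -cm_compA -cm_compBr; apply: nullh_compl.
Qed.

Lemma factors_shift n c W (g : chain_map c W) :
  factors g -> factors (cm_shift n g).
Proof.
move=> [p [pp [a [b gE]]]]; exists (shift n p); split; first exact: perf_shift.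
exists (cm_shift n a), (cm_shift n b).
by rewrite -cm_shift_comp -cm_shiftB; apply: nullh_shift.
Qed.

(** Applied to the identity of a homotopy-compact complex, this property exhibits it as a retract of
    a perfect one. Unlike perfection, it survives infinite direct sums. *)
Definition finitary W := forall c, hcompact c -> forall g : chain_map c W, factors g.

Lemma finitary_perf p : perf p -> finitary p.
Proof.
move=> pp c hc g; exists p; split=> //; exists g, (cm_id p).
by rewrite cm_comp1l subrr; apply: nullh0.
Qed.

Lemma finitary_shift n W : finitary W -> finitary (shift n W).
Proof.
move=> fW c hc g; have [f ->] := shift_transpose_cod g.
by apply/factors_compr/factors_shift/fW/hcompact_shift.
Qed.

Lemma finitary_bsum (J : eqType) (X : J -> complex R) :
  (forall j, finitary (X j)) -> finitary (bsum X).
Proof.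
move=> fX c hc g; have [s gs] := hc _ _ g.
have {}gs : nullh (g - keep X (undup s) \oC g).
  by apply: nullhBC; apply: keep_mono gs => j; rewrite mem_undup.
apply: (factors_eq gs); rewrite keep_sum ?undup_uniq //.
have -> : (\sum_(j <- undup s) binj X j \oC bproj X j) \oC g =
          \sum_(j <- undup s) binj X j \oC (bproj X j \oC g).
  elim/big_rec2: _ => [|j u v _ <-]; first exact: cm_comp0l.
  by rewrite cm_compDl cm_compA.
elim/big_ind: _ => [|u v|j _]; [exact: factors0 | exact: factorsD |].
exact/factors_compl/fX.
Qed.

(* With the perfect complex a through which the composite c -> cone f -> X[1]
   factors, a -> X[1] -> Y[1] extends over the cone of c -> a and so factors
   through a perfect q.  Then c -> a lifts to the fiber of a -> q, whose map to
   X[1] lifts to cone f; the two maps c -> cone f differ by a map into Y. *)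
Lemma finitary_cone X Y (f : chain_map X Y) :
  finitary X -> finitary Y -> finitary (cone f).
Proof.
move=> fX fY c hc g.
have [a [pa [u [v uv]]]] := finitary_shift (n := 1) fX hc (cone_out f \oC g).
have [k kE] : exists k : chain_map (cone u) (shift 1 Y),
    k \oC cone_in u = cm_shift 1 f \oC v.
  apply: cone_ext; rewrite -cm_compA.
  have := nullhB (nullh_compr g (nullh_cone_out f)) (nullh_compl (cm_shift 1 f) uv).
  by rewrite cm_compBr cm_compA subKr.
have [q [pq [a' [b kb]]]] :=
  finitary_shift (n := 1) fY (hcompact_cone (f := u) hc (perf_hcompact pa)) k.
pose t := a' \oC cone_in u.
have [w wE] : exists w : chain_map c (fib t), fib_map t \oC w = u.
  by apply: fib_lift; rewrite /t -cm_compA; apply/nullh_compl/nullh_cone_in.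
have [l lE] : exists l : chain_map (fib t) (cone f),
    cone_out f \oC l = v \oC fib_map t.
  apply: cone_lift; rewrite cm_compA -kE.
  have := nullhD (nullh_compr (cone_in u \oC fib_map t) kb)
    (nullh_compl b (nullh_fib t)).
  by rewrite cm_compBl /t !cm_compA subrK.
have [y gy] : exists y : chain_map c Y, nullh (g - l \oC w - cone_in f \oC y).
  by apply: cone_lift0; rewrite cm_compBr [_ \oC (l \oC w)]cm_compA lE -cm_compA wE.
have : factors (l \oC w + cone_in f \oC y).
  apply: factorsD; last exact/factors_compl/fY.
  exists (fib t); split; first exact: perf_fib.
  by exists w, l; apply: nullhBB.
by apply: factors_eq; rewrite opprD addrA.
Qed.

(** The closure of R under shifts, arbitrary direct sums and cones: what Brown's construction
    produces from perfect cells. *)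
Inductive loc : complex R -> Prop :=
| loc_sphere : loc (sphere R)
| loc_shift n X : loc X -> loc (shift n X)
| loc_bsum (J : eqType) (X : J -> complex R) : (forall j, loc (X j)) -> loc (bsum X)
| loc_cone X Y (f : chain_map X Y) : loc X -> loc Y -> loc (cone f).

Lemma loc_kproj X : loc X -> kproj X.
Proof.
elim=> *; [exact: kproj_sphere | exact: kproj_shift | exact: kproj_bsum |
  exact: kproj_cone].
Qed.

Lemma loc_finitary X : loc X -> finitary X.
Proof.
elim=> *; [exact/finitary_perf/perf_sphere | exact: finitary_shift |
  exact: finitary_bsum | exact: finitary_cone].
Qed.

End Perfect.

(** * Morphisms of D(R) as homotopy classes *)

Section DerivedHoms.
Variable R : pzRingType.
Implicit Types P X Y Z W C : complex R.

(** A cycle (x, y) has dx = 0 and s x = -dy. Injectivity on cohomology gives x = d x0, then y + s x0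
    is a cycle, equal to s z + dw by surjectivity, and (x, y) is the differential of (z - x0, w). *)
Lemma acyclic_cone X Y (s : chain_map X Y) : quasi_iso s -> acyclic (cone s).
Proof.
move=> qs i [x y] cxy.
have cx : @Defs.cycle R X (i + 1) x.
  move=> j e; have /= := congr1 fst (cxy (i + 1) erefl).
  rewrite sgn_by1 => /eqP; rewrite oppr_eq0 => /eqP.
  case: _ / e; rewrite (df_irr _ (erefl (i + 1 + 1))).
  exact.
have sxy : s (i + 1) x = df Y erefl (- y).
  have /= /eqP := congr1 snd (cxy (i + 1) erefl).
  by rewrite linearN addr_eq0 => /eqP.
have [sI _] := qs (i + 1); have [_ sS] := qs i.
have [h [e [x0 x0x]]] :=
  sI x cx (ex_intro _ i (ex_intro _ erefl (ex_intro _ _ (esym sxy)))).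
have eh : h = i by apply: (addIr 1).
subst h; have {x0x} x0x : df X (erefl (i + 1)) x0 = x by rewrite -x0x; apply: df_irr.
have cy : Defs.cycle (y + s i x0).
  move=> j f; case: _ / f; rewrite linearD -cmd x0x sxy linearN.
  exact: subrr.
have [z cz [h [f [w wE]]]] := sS _ cy.
have eh : h + 1 = i by [].
exists h, f, (cst X (esym f) (z - x0), w).
rewrite /= sgn_by1 cm_toE cm_cst cst_cst cst_id.
have dzx : df X (erefl (i + 1)) (z - x0) = - x by rewrite linearB /= cz x0x sub0r.
rewrite (df_cst _ _ (erefl (i + 1))) wE dzx opprK [s i _]linearB; congr (_, _).
by rewrite addrC addrA addrNK addrK.
Qed.

(** Since the cone of s is acyclic, a becomes null-homotopic in it, and exactness at Z provides the
    lift. *)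
Lemma kproj_lift P Y Z (s : chain_map Y Z) (a : chain_map P Z) :
  kproj P -> quasi_iso s -> exists b : chain_map P Y, nullh (a - s \oC b).
Proof. by move=> kP qs; apply: cone_in_ker; apply/kP/acyclic_cone. Qed.

(** A null-homotopy of s b lifts b[1] to the acyclic cone of s, and the lift is null-homotopic. *)
Lemma kproj_lift_uniq P Y Z (s : chain_map Y Z) (b : chain_map P Y) :
  kproj P -> quasi_iso s -> nullh (s \oC b) -> nullh b.
Proof.
move=> kP qs /(nullh_shift 1); rewrite cm_shift_comp => /cone_lift[u ub].
apply: (@nullh_shift_inv _ 1); rewrite -ub; apply: nullh_compl.
exact: kproj_shift kP _ (acyclic_cone qs) u.
Qed.

Lemma quasi_iso_fst X C : acyclic C -> quasi_iso (cm_fst X C).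
Proof.
move=> aC i; split=> [[x y] /dsum_cycle[cx cy] bx|x cx].
  by apply/dsum_boundary; split=> //; apply: aC.
exists (x, 0); last by rewrite /= subrr; apply: boundary0.
by apply/dsum_cycle; split=> // j e; rewrite linear0.
Qed.

Lemma quasi_iso_id X : quasi_iso (cm_id X).
Proof.
by move=> i; split=> [//|y cy]; exists y; rewrite //= subrr; apply: boundary0.
Qed.

Lemma quasi_iso_cancel X Y Z (s : chain_map Y Z) (f g : dhom X Y) :
  quasi_iso s -> dmap s \oD f =D dmap s \oD g -> f =D g.
Proof.
move=> qs sfg; apply: deq_trans (deq_sym (deq_idl f)) _.
apply: deq_trans (deq_comp (deq_sym (deq_invl qs)) (deq_refl f)) _.
apply: deq_trans (deq_sym (deq_assoc _ _ _)) _.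
apply: deq_trans (deq_comp (deq_refl _) sfg) _.
apply: deq_trans (deq_assoc _ _ _) _.
apply: deq_trans (deq_comp (deq_invl qs) (deq_refl g)) _.
exact: deq_idl.
Qed.

(* A null-homotopic map X -> Y factors through the contractible cone C of the
   identity of X, so two homotopic maps factor through X (+) C by two sections
   of the quasi-isomorphism X (+) C -> X. *)
Lemma deq_nullh X Y (f g : chain_map X Y) : nullh (f - g) -> dmap f =D dmap g.
Proof.
move=> fg.
have [k kE] : exists k : chain_map (cone (cm_id X)) Y, k \oC cone_in (cm_id X) = f - g.
  by apply: cone_ext; rewrite cm_comp1r.
have aC := acyclic_cone (@quasi_iso_id X); set C := cone _ in k kE aC.
pose r : chain_map (dsum X C) Y := g \oC cm_fst X C + k \oC cm_snd X C.
pose j := cone_in (cm_id X).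
have fE : f = r \oC (cm_inl X C + cm_inr X C \oC j).
  rewrite -[LHS](subrK g) -kE addrC; apply: chain_map_ext => i x.
  by rewrite [RHS]/= addr0 add0r.
have gE : g = r \oC cm_inl X C.
  by apply: chain_map_ext => i x; rewrite [RHS]/= linear0 addr0.
rewrite fE [X in _ =D dmap X]gE.
apply: deq_trans (deq_map_comp _ _) (deq_trans _ (deq_sym (deq_map_comp _ _))).
apply: deq_comp; first exact: deq_refl.
apply: (quasi_iso_cancel (quasi_iso_fst X aC)).
apply: deq_trans (deq_sym (deq_map_comp _ _)) (deq_trans _ (deq_map_comp _ _)).
by apply: deq_map => i x /=; rewrite addr0.
Qed.

(* [act f a b] states f a = b in D(R), recursively on the formal composite f
   and up to homotopy: on maps from a K-projective complex, formal inverses of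
   quasi-isomorphisms act by lifting. *)
Fixpoint act X Y (f : dhom X Y) P : chain_map P X -> chain_map P Y -> Prop :=
  match f with
  | dmap _ _ u => fun a b => nullh (b - u \oC a)
  | dinv _ _ s _ => fun a b => nullh (a - s \oC b)
  | dcomp _ _ _ g f => fun a b => exists m, act f a m /\ act g m b
  end.

Lemma act_deq_dmap X Y (f : dhom X Y) P (a : chain_map P X) b :
  act f a b -> f \oD dmap a =D dmap b.
Proof.
elim: f P a b => {X Y} [X Y u|X Y s qs|X Y Z g IHg f IHf] P a b /=.
- move/nullhBC/deq_nullh; exact: deq_trans (deq_sym (deq_map_comp _ _)).
- move/deq_nullh => ab; apply: deq_trans (deq_comp (deq_refl _) ab) _.
  apply: deq_trans (deq_comp (deq_refl _) (deq_map_comp _ _)) _.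
  apply: deq_trans (deq_assoc _ _ _) _.
  exact: deq_trans (deq_comp (deq_invl qs) (deq_refl _)) (deq_idl _).
- case=> m [/IHf fm /IHg gb]; apply: deq_trans (deq_sym (deq_assoc _ _ _)) _.
  exact: deq_trans (deq_comp (deq_refl _) fm) gb.
Qed.

Lemma act_homotopic X Y (f : dhom X Y) P (a a' : chain_map P X) b b' :
  nullh (a - a') -> nullh (b - b') -> act f a b -> act f a' b'.
Proof.
elim: f P a a' b b' => {X Y} [X Y u|X Y s qs|X Y Z g IHg f IHf] P a a' b b' /= aa bb.
- move=> ab; apply: nullhBT (nullhBC bb) (nullhBT ab _).
  by rewrite -cm_compBr; apply: nullh_compl.
- move=> ab; apply: nullhBT (nullhBC aa) (nullhBT ab _).
  by rewrite -cm_compBr; apply: nullh_compl.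
- case=> m [am mb]; exists m; split.
    by apply: IHf am; rewrite //; apply: nullhBB.
  by apply: IHg mb; rewrite //; apply: nullhBB.
Qed.

Lemma actD X Y (f : dhom X Y) P (a a' : chain_map P X) b b' :
  act f a b -> act f a' b' -> act f (a + a') (b + b').
Proof.
elim: f P a a' b b' => {X Y} [X Y u|X Y s qs|X Y Z g IHg f IHf] P a a' b b' /=.
- by move=> ab ab'; rewrite cm_compDr opprD addrACA; apply: nullhD.
- by move=> ab ab'; rewrite cm_compDr opprD addrACA; apply: nullhD.
- case=> m [am mb] [m' [am' mb']]; exists (m + m'); split; [exact: IHf | exact: IHg].
Qed.

Lemma actN X Y (f : dhom X Y) P (a : chain_map P X) b :
  act f a b -> act f (- a) (- b).
Proof.
have cN U V W (u : chain_map V W) (v : chain_map U V) : u \oC (- v) = - (u \oC v).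
  by rewrite -[- v]add0r cm_compBr cm_comp0r add0r.
elim: f P a b => {X Y} [X Y u|X Y s qs|X Y Z g IHg f IHf] P a b /=.
- by rewrite cN -opprD; apply: nullhN.
- by rewrite cN -opprD; apply: nullhN.
- case=> m [am mb]; exists (- m); split; [exact: IHf | exact: IHg].
Qed.

Section KprojSource.
Variables (P : complex R) (kP : kproj P).

Lemma act_exists X Y (f : dhom X Y) (a : chain_map P X) : exists b, act f a b.
Proof.
elim: f a => {X Y} [X Y u|X Y s qs|X Y Z g IHg f IHf] a /=.
- by exists (u \oC a); apply: nullhBB.
- exact: kproj_lift.
- by have [m am] := IHf a; have [b mb] := IHg m; exists b, m.
Qed.

Lemma act_uniq0 X Y (f : dhom X Y) (a : chain_map P X) b :
  act f a b -> nullh a -> nullh b.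
Proof.
elim: f a b => {X Y} [X Y u|X Y s qs|X Y Z g IHg f IHf] a b /=.
- by move=> ab na; apply: nullh_eq ab _; apply: nullh_compl.
- move=> ab na; apply: (kproj_lift_uniq kP qs).
  exact: nullh_eq (nullhBC ab) na.
- by case=> m [am mb] /(IHf _ _ am); apply: IHg.
Qed.

Lemma act_uniq X Y (f : dhom X Y) (a a' : chain_map P X) b b' :
  act f a b -> act f a' b' -> nullh (a - a') -> nullh (b - b').
Proof. by move=> ab /actN/(actD ab)/act_uniq0. Qed.

(** Each rule generating [=D] is sound for the action; the two rules for inverses amount to
    existence and uniqueness of lifts along a quasi-isomorphism. With [act_deq_dmap] this identifies
    D(R)(P, X) with homotopy classes of maps. *)
Lemma act_deq X Y (f g : dhom X Y) (a : chain_map P X) b :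
  f =D g -> act f a b <-> act g a b.
Proof.
move=> fg; elim: fg a b => {X Y f g}
 [X Y f|X Y f g _ IH|X Y f g h _ IH1 _ IH2|X Y Z g g' f f' _ IHg _ IHf
 |X Y Z W h g f|X Y f|X Y f|X Y f g fg|X Y Z g f|X Y s qs|X Y s qs] a b /=.
- by [].
- by rewrite IH.
- by rewrite IH1.
- by split=> -[m [am mb]]; exists m; split;
    by [rewrite -IHf | rewrite -IHg | rewrite IHf | rewrite IHg].
- split=> [[m [[l [al lm]] mb]]|[m [am [l [ml lb]]]]].
    by exists l; split=> //; exists m.
  by exists l; split=> //; exists m.
- split=> [[m [am]]|ab]; last first.
    by exists b; split; rewrite ?cm_comp1l //; apply: nullhBB.
  by rewrite cm_comp1l => /nullhBC mb; apply: act_homotopic am.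
- split=> [[m [am]]|ab]; last first.
    by exists a; split; rewrite ?cm_comp1l //; apply: nullhBB.
  by rewrite cm_comp1l in am => mb; apply: act_homotopic mb.
- by have -> : f = g by apply: chain_map_ext.
- split=> [ab|[m [am mb]]].
    by exists (f \oC a); rewrite cm_compA; split=> //; apply: nullhBB.
  by apply: nullhBT mb _; rewrite -cm_compA -cm_compBr; apply: nullh_compl.
- rewrite cm_comp1l; split=> [[m [ma mb]]|ab].
    have := nullhBT (nullhBC mb) ma; rewrite -cm_compBr.
    exact: kproj_lift_uniq.
  exists (s \oC a); split=> //; rewrite -cm_compBr.
  by apply/nullh_compl/nullhBC.
- rewrite cm_comp1l; split=> [[m [am bm]]|ab].
    exact: nullhBT bm (nullhBC am).
  have [m am] := kproj_lift a kP qs; exists m; split=> //.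
  exact: nullhBT ab am.
Qed.

Lemma dmap_full X (f : dhom P X) : exists u, f =D dmap u.
Proof.
have [u /act_deq_dmap fu] := act_exists f (cm_id P); exists u.
exact: deq_trans (deq_sym (deq_idr f)) fu.
Qed.

End KprojSource.

(** The word for f (+) id acts on the first coordinate and carries the second along unchanged. *)
Lemma act_ddsumr C X Y (f : dhom X Y) P (a : chain_map P (dsum X C)) b :
  act f (cm_fst X C \oC a) b ->
  act (ddsumr C f) a (cm_inl Y C \oC b + cm_inr Y C \oC (cm_snd X C \oC a)).
Proof.
elim: f P a b => {X Y} [X Y u|X Y s qs|X Y Z g IHg f IHf] P a b /=.
- move/(nullh_compl (cm_inl Y C)); congr nullh; apply: chain_map_ext => i x.
  rewrite !cmBE cmDE /=; case: (a i x) => y z /=.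
  by congr (_, _); rewrite /= ?addr0 ?add0r ?subrr.
- move/(nullh_compl (cm_inl Y C)); congr nullh; apply: chain_map_ext => i x.
  rewrite !cmBE /=; case: (a i x) => y z /=.
  by congr (_, _); rewrite /= ?addr0 ?add0r ?subrr.
- case=> m [am mb]; exists (cm_inl Y C \oC m + cm_inr Y C \oC (cm_snd X C \oC a)).
  split; first exact: IHf.
  have := IHg _ (cm_inl Y C \oC m + cm_inr Y C \oC (cm_snd X C \oC a)) b.
  have -> : cm_fst Y C \oC (cm_inl Y C \oC m + cm_inr Y C \oC (cm_snd X C \oC a)) = m.
    by apply: chain_map_ext => i x; rewrite /= addr0.
  have -> : cm_snd Y C \oC (cm_inl Y C \oC m + cm_inr Y C \oC (cm_snd X C \oC a))
     = cm_snd X C \oC a.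
    by apply: chain_map_ext => i x; rewrite /= add0r.
  exact.
Qed.

Lemma act_dadd X Y (f g : dhom X Y) P (a : chain_map P X) b b' :
  act f a b -> act g a b' -> act (dadd f g) a (b + b').
Proof.
have n0 Q Z (c c' : chain_map Q Z) : c = c' -> nullh (c - c').
  by move->; apply: nullhBB.
move=> ab ab'.
exists (cm_diag X \oC a); split; first exact: n0.
exists (cm_inl Y X \oC b' + cm_inr Y X \oC a); split.
  have := @act_ddsumr X _ _ g _ (cm_diag X \oC a) b'.
  have -> : cm_fst X X \oC (cm_diag X \oC a) = a by apply: chain_map_ext.
  have -> : cm_snd X X \oC (cm_diag X \oC a) = a by apply: chain_map_ext.
  exact.
exists (cm_inl X Y \oC a + cm_inr X Y \oC b'); split.
  apply: n0; apply: chain_map_ext => i x.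
  by congr (_, _); rewrite /= ?addr0 ?add0r.
exists (cm_inl Y Y \oC b + cm_inr Y Y \oC b'); split.
  have := @act_ddsumr Y _ _ f _ (cm_inl X Y \oC a + cm_inr X Y \oC b') b.
  have -> : cm_fst X Y \oC (cm_inl X Y \oC a + cm_inr X Y \oC b') = a.
    by apply: chain_map_ext => i x; rewrite /= addr0.
  have -> : cm_snd X Y \oC (cm_inl X Y \oC a + cm_inr X Y \oC b') = b'.
    by apply: chain_map_ext => i x; rewrite /= add0r.
  exact.
by apply: n0; apply: chain_map_ext => i x; rewrite /= addr0 add0r.
Qed.

(** With [act_dadd], this matches the group structure of D(R), defined by diagonals, with the
    pointwise one on representatives. *)
Lemma act_dzero X Y P (a : chain_map P X) : act (dzero X Y) a 0.
Proof.
rewrite /=; have -> : cm_zero X Y \oC a = 0 by apply: chain_map_ext.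
by apply: nullhBB.
Qed.

Lemma act_dbigsum (I : eqType) X Y (s : seq I) (f : I -> dhom X Y) P
    (a : chain_map P X) (b : I -> chain_map P Y) :
  (forall i, act (f i) a (b i)) -> act (dbigsum s f) a (\sum_(i <- s) b i).
Proof.
move=> fb; elim: s => [|i s IHs]; first by rewrite big_nil; apply: act_dzero.
by rewrite big_cons; apply: act_dadd.
Qed.

Lemma act_comp X Y Z (g : dhom Y Z) (f : dhom X Y) P (a : chain_map P X) b c :
  act f a b -> act g b c -> act (g \oD f) a c.
Proof. by move=> ab bc; exists b. Qed.

Lemma act_dmap_comp X Y (u : chain_map X Y) P (a : chain_map P X) :
  act (dmap u) a (u \oC a).
Proof. by rewrite /= subrr; apply: nullh0. Qed.

(** The converse of [act_deq]: q becomes invertible in D(R), so a common value on q determines the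
    morphism. *)
Lemma deq_act P X Y (q : chain_map P X) (f g : dhom X Y) b :
  quasi_iso q -> act f q b -> act g q b -> f =D g.
Proof.
move=> qq /act_deq_dmap fb /act_deq_dmap gb.
have H h : h \oD dmap q =D dmap b -> h =D dmap b \oD dinv qq.
  move=> hb; apply: deq_trans (deq_comp hb (deq_refl (dinv qq))).
  apply: deq_trans (deq_sym (deq_idr h)) _.
  apply: deq_trans (deq_comp (deq_refl h) (deq_sym (deq_invr qq))) _.
  exact: deq_assoc.
exact: deq_trans (H _ fb) (deq_sym (H _ gb)).
Qed.

End DerivedHoms.

(** * Brown representability *)

Section Telescope.
Variables (R : pzRingType) (X : nat -> complex R).
Variable j : forall n, chain_map (X n) (X n.+1).
Implicit Types c : complex R.

(** The map 1 - shift, whose cone is the homotopy colimit of the sequence. *)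
Definition tel_map : chain_map (bsum X) (bsum X) :=
  bcase (fun n => binj X n - binj X n.+1 \oC j n).

Lemma tel_map_inj n : tel_map \oC binj X n = binj X n - binj X n.+1 \oC j n.
Proof. exact: bcase_inj. Qed.

Lemma tel_map_proj0 : bproj X 0 \oC tel_map = bproj X 0.
Proof.
apply: bsum_ext => m; rewrite -cm_compA tel_map_inj cm_compBr cm_compA.
rewrite (@bproj0 _ _ _ m.+1) //.
by rewrite cm_comp0l subr0.
Qed.

Lemma tel_map_projS n :
  bproj X n.+1 \oC tel_map = bproj X n.+1 - j n \oC bproj X n.
Proof.
apply: bsum_ext => m; rewrite -cm_compA tel_map_inj cm_compBr cm_compBl cm_compA.
congr (_ - _); rewrite -[RHS]cm_compA; have [<-|mn] := eqVneq m n.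
  by rewrite !bprojK cm_comp1l cm_comp1r.
by rewrite !bproj0 // cm_comp0l cm_comp0r.
Qed.

(** The component n + 1 of [tel_map \oC u] is that of u minus the transition map applied to
    component n. By induction all components of u are null-homotopic, and by compactness finitely
    many of them determine u. *)
Lemma tel_map_mono c (u : chain_map c (bsum X)) :
  hcompact c -> nullh (tel_map \oC u) -> nullh u.
Proof.
move=> hc tu.
have pu n : nullh (bproj X n \oC u).
  elim: n => [|n IHn]; have := nullh_compl (bproj X _) tu.
    by move/(_ 0); rewrite cm_compA tel_map_proj0.
  move/(_ n.+1); rewrite cm_compA tel_map_projS cm_compBl -cm_compA.
  by move/nullh_eq; apply; apply: nullh_compl.
have [s su] := hc _ _ u; apply: nullh_eq (nullhBC (keep_mono (t := undup s) _ su)) _.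
  by move=> n; rewrite mem_undup.
rewrite keep_sum ?undup_uniq //.
elim/big_ind: _ => [|f g nf ng|n _]; first by rewrite cm_comp0l; apply: nullh0.
  by rewrite cm_compDl; apply: nullhD.
by rewrite -cm_compA; apply: nullh_compl.
Qed.

Definition tel := cone tel_map.
Definition tel_in n : chain_map (X n) tel := cone_in tel_map \oC binj X n.

Lemma tel_inS n : nullh (tel_in n - tel_in n.+1 \oC j n).
Proof.
rewrite /tel_in -cm_compA -cm_compBr -tel_map_inj cm_compA.
exact/nullh_compr/nullh_cone_in.
Qed.

Lemma tel_factor c (f : chain_map c tel) : hcompact c ->
  exists n (g : chain_map c (X n)), nullh (f - tel_in n \oC g).
Proof.
move=> hc.
have [g fg] : exists g : chain_map c (bsum X), nullh (f - cone_in tel_map \oC g).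
  (* [tel_map_mono] concerns maps into the unshifted sum; the composite into its shift is therefore
     transposed to a map out of c[-1]. *)
  apply: cone_lift0; have [u uE] := shift_transpose_cod (cone_out tel_map \oC f).
  rewrite uE; apply/nullh_compr/nullh_shift/tel_map_mono; first exact: hcompact_shift.
  apply: (@nullh_shift_inv _ 1); apply: (@nullh_reshift _ _ _ (addrN 1)).
  by rewrite cm_shift_comp -cm_compA -uE cm_compA; apply/nullh_compr/nullh_cone_out.
(* Asking for a factorization at all late stages, and not at one, makes the property stable under
   sums. *)
pose reach (v : chain_map c tel) := exists n, forall m, (n <= m)%N ->
  exists g' : chain_map c (X m), nullh (v - tel_in m \oC g').
have reachE v : reach v -> nullh (f - v) ->
    exists n (g : chain_map c (X n)), nullh (f - tel_in n \oC g).
  move=> [n /(_ n (leqnn n))[g' vg']] fv; exists n, g'; exact: nullhBT fv vg'.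
have reach0 : reach 0.
  by exists 0 => m _; exists 0; rewrite cm_comp0r subrr; apply: nullh0.
have reachD v w : reach v -> reach w -> reach (v + w).
  move=> [n vn] [n' wn']; exists (maxn n n') => m; rewrite geq_max => /andP[nm n'm].
  have [g1 vg1] := vn _ nm; have [g2 wg2] := wn' _ n'm; exists (g1 + g2).
  by rewrite cm_compDr opprD addrACA; apply: nullhD.
have reach_in n (h : chain_map c (X n)) : reach (tel_in n \oC h).
  exists n; elim=> [|m IHm].
    by rewrite leqn0 => /eqP n0; move: h; rewrite n0 => h; exists h; apply: nullhBB.
  rewrite leq_eqVlt => /predU1P[<-|/IHm[h' hh']].
    by exists h; apply: nullhBB.
  exists (j m \oC h'); apply: nullhBT hh' _.
  by rewrite cm_compA -cm_compBl; apply/nullh_compr/tel_inS.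
have [s sg] := hc _ _ g.
have {}sg := nullhBC (keep_mono (fun n => _ : n \in s -> n \in undup s) sg).
apply: (@reachE (cone_in tel_map \oC (keep X (undup s) \oC g))); last first.
  apply: nullhBT fg _; rewrite -cm_compBr; apply: nullh_compl; apply: sg.
  by move=> n; rewrite mem_undup.
rewrite keep_sum ?undup_uniq //.
elim/big_ind: _ => [|v w rv rw|n _]; first by rewrite cm_comp0l cm_comp0r.
  by rewrite cm_compDl cm_compDr; apply: reachD.
by rewrite -cm_compA cm_compA; apply: reach_in.
Qed.

End Telescope.

(** * Brown's construction by attaching cells *)

Section Brown.
Variables (R : pzRingType) (Phi : complex R -> Type).
(** [Res f y a] means that y restricts to a along f, [Ker f y] that y vanishes along f. Relations
    suit both uses below: for Hom(-, X) a restriction is determined only up to homotopy. *)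
Variable Res : forall A Y, chain_map A Y -> Phi Y -> Phi A -> Prop.
Variable Ker : forall A Y, chain_map A Y -> Phi Y -> Prop.

Hypothesis Res_bsum : forall (J : eqType) (X : J -> complex R)
  (x : forall j, Phi (X j)), exists y : Phi (bsum X), forall j, Res (binj X j) y (x j).
Hypothesis Res_cone : forall A Y (f : chain_map A Y) (y : Phi Y), Ker f y ->
  exists x : Phi (cone f), Res (cone_in f) x y.
Hypothesis Ker_bsum : forall (J : eqType) (X : J -> complex R) Y
  (f : chain_map (bsum X) Y) (y : Phi Y), (forall j, Ker (f \oC binj X j) y) -> Ker f y.
Hypothesis KerB : forall A Y (f g : chain_map A Y) y a,
  Res f y a -> Res g y a -> Ker (f - g) y.
Hypothesis Res_comp : forall A B Y (f : chain_map B Y) (g : chain_map A B) y b a,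
  Res f y b -> Res g b a -> Res (f \oC g) y a.
Hypothesis Ker_comp : forall A B Y (f : chain_map B Y) (g : chain_map A B) y b,
  Res f y b -> Ker (f \oC g) y -> Ker g b.
Hypothesis Ker_homotopic : forall A Y (f g : chain_map A Y) y,
  nullh (f - g) -> Ker f y -> Ker g y.

Variables (T : Type) (S : T -> complex R) (W : T -> Type).
Variable gen : forall t, W t -> Phi (S t).
Hypothesis S_compact : forall t, hcompact (S t).

(** All maps from a test object along which x vanishes are coned off at once. [classicType] supplies
    the equality on indices that [bsum] demands. *)
Definition cells (X : complex R) (x : Phi X) :=
  classicType {t : T & {f : chain_map (S t) X | Ker f x}}.

Definition attach X (x : Phi X) :
    chain_map (bsum (fun k : cells x => S (projT1 k))) X :=
  bcase (fun k : cells x => sval (projT2 k)).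

Lemma attach_ker X (x : Phi X) : Ker (attach x) x.
Proof. by apply: Ker_bsum => k; rewrite bcase_inj; apply: (svalP (projT2 k)). Qed.

Definition next (s : {X : complex R & Phi X}) : {X : complex R & Phi X} :=
  existT _ (cone (attach (projT2 s)))
    (sval (cid (Res_cone (attach_ker (projT2 s))))).

Definition gens := classicType {t : T & W t}.

Definition stage0 : {X : complex R & Phi X} :=
  existT _ (bsum (fun k : gens => S (projT1 k)))
    (sval (cid (Res_bsum (fun k : gens => gen (projT2 k))))).

Definition stage n := projT1 (iter n next stage0).
Definition stage_elt n : Phi (stage n) := projT2 (iter n next stage0).

Definition stage_map n : chain_map (stage n) (stage n.+1) :=
  cone_in (attach (stage_elt n)).

Lemma stage_map_res n : Res (stage_map n) (stage_elt n.+1) (stage_elt n).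
Proof. exact: (svalP (cid (Res_cone (attach_ker (stage_elt n))))). Qed.

Lemma stage_kill n t (f : chain_map (S t) (stage n)) :
  Ker f (stage_elt n) -> nullh (stage_map n \oC f).
Proof.
move=> fk; pose k : cells (stage_elt n) := existT _ t (exist _ f fk).
have -> : f = attach (stage_elt n) \oC
    binj (fun k : cells (stage_elt n) => S (projT1 k)) k.
  by rewrite bcase_inj.
by rewrite cm_compA; apply/nullh_compr/nullh_cone_in.
Qed.

Lemma stage_loc n : (forall t, loc (S t)) -> loc (stage n).
Proof.
move=> lS; elim: n => [|n IHn]; first by apply: loc_bsum => k.
by apply: loc_cone IHn; apply: loc_bsum => k.
Qed.

Theorem brown : exists (X : complex R) (x : Phi X),
  [/\ (forall t, loc (S t)) -> loc X,
      forall t (w : W t), exists f : chain_map (S t) X, Res f x (gen w) &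
      forall t (f : chain_map (S t) X), Ker f x -> nullh f].
Proof.
have [y yR] := Res_bsum stage_elt.
(* Compatible elements agree along the two terms of 1 - shift, so their union over the sum extends
   to the telescope. *)
have yK : Ker (tel_map stage_map) y.
  apply: Ker_bsum => n; rewrite tel_map_inj; apply: KerB (yR n) _.
  exact: Res_comp (yR n.+1) (stage_map_res n).
have [x xR] := Res_cone yK; exists (tel stage_map), x.
have xn n : Res (tel_in stage_map n) x (stage_elt n) by apply: Res_comp xR (yR n).
split=> [lS|t w|t f fK].
- by apply: loc_cone; apply: loc_bsum => n; apply: stage_loc.
- exists (tel_in stage_map 0 \oC
    binj (fun k : gens => S (projT1 k)) (existT _ t w : gens)).
  apply: Res_comp (xn 0) _.
  exact: (svalP (cid (Res_bsum (fun k : gens => gen (projT2 k)))) (existT _ t w)).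
(* By compactness f comes from some stage n, where it is a cell, and it dies at stage n + 1. *)
- have [n [g fg]] := tel_factor f (@S_compact t).
  have gK := Ker_comp (xn n) (Ker_homotopic fg fK); apply: nullh_eq fg _.
  have := nullh_compl (tel_in stage_map n.+1) (stage_kill gK).
  rewrite cm_compA => H; apply: nullh_eq H.
  by rewrite -cm_compBl; apply/nullh_compr/tel_inS.
Qed.

End Brown.

(** * K-projective resolutions *)

Section Resolution.
Variable R : pzRingType.
Implicit Types X Y P : complex R.

Lemma cycle_cst X i j (e : i = j) (x : X i) :
  Defs.cycle x -> Defs.cycle (cst X e x).
Proof. by case: _ / e. Qed.

Lemma boundary_cst X i j (e : i = j) (x : X i) :
  boundary (cst X e x) <-> boundary x.
Proof. by case: _ / e. Qed.

(** The shift by -i places R in degree i. The value at the generator is read after transposing to a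
    map from the unshifted sphere to X[i]. *)
Lemma shifted_sphere_map X i (x : X i) : Defs.cycle x ->
  exists f : chain_map (shift (- i) (sphere R)) X,
    (cm_shift i f \oC reshift (addrN i) _) 0 (sphere1 R) = cst X (esym (add0r i)) x.
Proof.
move=> /(cycle_cst (esym (add0r i))) cx.
have cx' : @Defs.cycle R (shift i X) 0 (cst X (esym (add0r i)) x) by apply/shift_cycle.
have [f fE] := shift_transpose_cod (sphere_map cx'); exists f.
by rewrite -fE sphere_mapE.
Qed.

Lemma shifted_sphere_nullh X i (f : chain_map (shift (- i) (sphere R)) X) :
  nullh f <->
  @boundary R X (0 + i) ((cm_shift i f \oC reshift (addrN i) _) 0 (sphere1 R)).
Proof.
split=> [/(nullh_shift i)/(nullh_compr (reshift (addrN i) _)) /boundary_sphere|b].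
  by move/shift_boundary.
apply: (@nullh_shift_inv _ i); apply: (@nullh_reshift _ _ _ (addrN i)).
exact/nullh_sphere/shift_boundary.
Qed.

(** The test objects are all shifts of R. Maps from them are cohomology classes, so the universal
    element is a map bijective on cohomology. *)
Lemma resolution X : exists P (q : chain_map P X), loc P /\ quasi_iso q.
Proof.
pose Res A Y (f : chain_map A Y) (y : chain_map Y X) a := nullh (a - y \oC f).
pose Ker A Y (f : chain_map A Y) (y : chain_map Y X) := nullh (y \oC f).
have [||||||||P [q [lP qS qI]]] := @brown R (fun Y => chain_map Y X) Res Ker _ _ _ _ _ _ _
  int (fun n => shift n (sphere R)) (fun n => chain_map (shift n (sphere R)) X)
  (fun _ => id).
- by move=> J Y x; exists (bcase x) => j; rewrite /Res bcase_inj.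
- move=> A Y f y /cone_ext[x xy]; exists x; rewrite /Res xy; exact: nullhBB.
- by move=> J Z Y f y fy; apply: nullh_bsum => j; rewrite -cm_compA; apply: fy.
- move=> A Y f g y a /nullhBC fa ga; rewrite /Ker cm_compBr; exact: nullhBT fa ga.
- move=> A B Y f g y b a yb ba; apply: nullhBT ba _.
  by rewrite cm_compA -cm_compBl; apply: nullh_compr.
- move=> A B Y f g y b yb; rewrite /Ker cm_compA => yfg; apply: nullh_eq yfg.
  by rewrite -cm_compBl; apply: nullh_compr.
- move=> A Y f g y /nullhBC fg; rewrite /Ker; apply: nullh_eq.
  by rewrite -cm_compBr; apply: nullh_compl.
- by move=> n; apply/hcompact_shift/hcompact_sphere.
exists P, q; split; first by apply: lP => n; apply/loc_shift/loc_sphere.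
move=> i; split=> [x cx bx|y cy].
  have [f fx] := shifted_sphere_map cx.
  have /qI/shifted_sphere_nullh : nullh (q \oC f).
    apply/shifted_sphere_nullh; rewrite cm_shift_comp -cm_compA.
    by rewrite -[X in boundary X]/(q (0 + i) _) fx cm_cst; apply/boundary_cst.
  by rewrite fx => /boundary_cst.
have [w wy] := shifted_sphere_map cy; have [f wf] := qS _ w.
pose g := cm_shift i f \oC reshift (addrN i) _.
have gc : Defs.cycle (g 0 (sphere1 R) : P (0 + i)).
  exact: (iffLR (shift_cycle _) (sphere_cycle g)).
exists (cst P (add0r i) (g 0 (sphere1 R))); first exact: cycle_cst.
have := iffLR (shifted_sphere_nullh _) wf.
rewrite cm_shiftB cm_compBl cmBE wy cm_shift_comp -cm_compA.
rewrite -[X in _ - X]/(q (0 + i) (g 0 (sphere1 R))) => H.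
apply/(boundary_cst (esym (add0r i))); rewrite linearB /= cm_cst cst_cst cst_id.
exact: H.
Qed.

End Resolution.

(** * Coproducts and compact objects of D(R) *)

Section Coproducts.
Variable R : pzRingType.
Implicit Types c p P X Y : complex R.

Lemma act0 X Y (f : dhom X Y) P : act f (0 : chain_map P X) 0.
Proof.
elim: f => {X Y} [X Y u|X Y s qs|X Y Z g IHg f IHf] /=.
- by rewrite cm_comp0r subrr; apply: nullh0.
- by rewrite cm_comp0r subrr; apply: nullh0.
- by exists 0.
Qed.

Lemma act_sum (I : Type) (r : seq I) X Y (f : dhom X Y) P
    (a : I -> chain_map P X) (b : I -> chain_map P Y) :
  (forall i, act f (a i) (b i)) -> act f (\sum_(i <- r) a i) (\sum_(i <- r) b i).
Proof.
move=> ab; elim/big_rec2: _ => [|i a' b' _ ab']; [exact: act0 | exact: actD].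
Qed.

Lemma act_precomp X Y (f : dhom X Y) P Q (a : chain_map P X) b (u : chain_map Q P) :
  act f a b -> act f (a \oC u) (b \oC u).
Proof.
elim: f P Q a b u => {X Y} [X Y v|X Y s qs|X Y Z g IHg f IHf] P Q a b u /=.
- by rewrite cm_compA -cm_compBl; apply: nullh_compr.
- by rewrite cm_compA -cm_compBl; apply: nullh_compr.
- by case=> m [am mb]; exists (m \oC u); split; [exact: IHf | exact: IHg].
Qed.

Lemma boundaryP X i (x : X i) :
  boundary x <-> exists y : X (i - 1), df X (predzK i) y = x.
Proof.
split=> [[h [e [y <-]]]|[y yx]]; last by exists (i - 1), (predzK i), y.
have eh : h = i - 1 by rewrite -e addrK.
by exists (cst X eh y); rewrite (df_cst _ _ e).
Qed.

(** Primitives are chosen on a finite support and taken to be 0 elsewhere; arbitrary choices would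
    leave the direct sum. *)
Lemma boundary_bsum (J : eqType) (X : J -> complex R) i (x : bsum X i) :
  (forall j, boundary (x j)) -> boundary x.
Proof.
move=> bx; have [s xs] := dsupp x.
pose y0 j := sval (cid (iffLR (boundaryP (x j)) (bx j))).
have y0P j : df (X j) (predzK i) (y0 j) = x j.
  exact: svalP (cid (iffLR (boundaryP (x j)) (bx j))).
have yS : exists t : seq J, forall j, j \notin t -> (if j \in s then y0 j else 0) = 0.
  by exists s => j /negPf->.
apply/boundaryP; exists (Dsm yS); apply: dsm_eq => j /=.
by case: ifPn => [_|/xs->]; rewrite ?y0P ?linear0.
Qed.

Section BsumMap.
Variables (J : eqType) (X Y : J -> complex R) (q : forall j, chain_map (X j) (Y j)).

Lemma bmap_subproof (i i' : int) (e : i + 1 = i') (x : bsum X i) :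
  dsm_map (fun j => q j i') (df (bsum X) e x) =
  df (bsum Y) e (dsm_map (fun j => q j i) x).
Proof. by apply: dsm_eq => j /=; rewrite cmd. Qed.

Definition bmap : chain_map (bsum X) (bsum Y) :=
  @ChainMap R (bsum X) (bsum Y) (fun i => dsm_map (fun j => q j i)) bmap_subproof.

Lemma bmap_inj j : bmap \oC binj X j = binj Y j \oC q j.
Proof.
apply: chain_map_ext => i x; apply: dsm_eq => j' /=; rewrite /dcoerce.
by case: eqP => [e|_]; [case: _ / e | rewrite linear0].
Qed.

Lemma quasi_iso_bmap : (forall j, quasi_iso (q j)) -> quasi_iso bmap.
Proof.
move=> qq i; split=> [x cx bx|y cy].
  apply: boundary_bsum => j; apply: (qq j i).1.
    by move=> l e; have /= /(congr1 (fun z : dsm _ => z j)) := cx l e.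
  have [h [e [y yx]]] := bx; exists h, e, (y j).
  by rewrite -[LHS]/((df (bsum Y) e y) j) yx.
have cyj j : Defs.cycle (y j).
  by move=> l e; have /= /(congr1 (fun z : dsm _ => z j)) := cy l e.
have xE j : exists x : X j i, Defs.cycle x /\ boundary (y j - q j i x).
  by have [x cx bx] := (qq j i).2 _ (cyj j); exists x.
have [s ys] := dsupp y.
pose x0 j := if j \in s then sval (cid (xE j)) else 0.
have xS : exists t : seq J, forall j, j \notin t -> x0 j = 0.
  by exists s => j; rewrite /x0 => /negPf->.
exists (Dsm xS : bsum X i).
  move=> l e; apply: dsm_eq => j /=; rewrite /x0.
  case: ifP => _; last by rewrite linear0.
  by case: cid => x [cx bx]; apply: cx.
apply: boundary_bsum => j; rewrite -[y - _]/(_ + _) /= /x0; case: ifPn => js.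
  by case: cid => x [].
by rewrite ys // linear0 subrr; apply: boundary0.
Qed.

End BsumMap.

(** The sum of K-projective resolutions of the summands is a K-projective resolution of the sum, and
    homotopy classes of maps out of a direct sum are families of homotopy classes. *)
Lemma bsum_coproduct (I : eqType) (X : I -> complex R) :
  is_coproduct (fun i => dmap (binj X i)).
Proof.
move=> Y g.
have res i : exists Pq : {P : complex R & chain_map P (X i)},
    kproj (projT1 Pq) /\ quasi_iso (projT2 Pq).
  by have [P [q [/loc_kproj kP qq]]] := resolution (X i); exists (existT _ P q).
pose P i := projT1 (sval (cid (res i))).
pose q i : chain_map (P i) (X i) := projT2 (sval (cid (res i))).
have kP i : kproj (P i) by have [] := svalP (cid (res i)).
have qq i : quasi_iso (q i) by have [] := svalP (cid (res i)).
have qb := quasi_iso_bmap qq.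
split.
  pose b i := sval (cid (act_exists (kP i) (g i) (q i))).
  have bP i : act (g i) (q i) (b i) := svalP (cid (act_exists (kP i) (g i) (q i))).
  exists (dmap (bcase b) \oD dinv qb) => i; apply: deq_act (qq i) _ (bP i).
  exists (binj X i \oC q i); split; first exact: nullhBB.
  by exists (binj P i); split; rewrite /= ?bmap_inj ?bcase_inj; apply: nullhBB.
move=> h h' hh'; have kb := kproj_bsum kP.
have [b hb] := act_exists kb h (bmap q); have [b' hb'] := act_exists kb h' (bmap q).
apply: (deq_act qb hb); apply: (act_homotopic (nullhBB (bmap q)) _ hb').
apply: nullhBC; apply: nullh_binj => i.
have aux (k : dhom (bsum X) Y) d : act k (bmap q) d ->
    act (k \oD dmap (binj X i)) (q i) (d \oC binj P i).
  move=> kd; exists (binj X i \oC q i); split; first exact: nullhBB.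
  by rewrite -bmap_inj; apply: act_precomp.
exact: (act_uniq (kP i) (iffLR (act_deq (kP i) _ _ (hh' i)) (aux _ _ hb))
  (aux _ _ hb') (nullhBB _)).
Qed.

(** Compactness speaks of every coproduct S in D(R), [perf_hcompact] of the explicit sum only. The
    comparison morphisms t and t' pass between them. *)
Lemma perf_compact p : perf p -> compact p.
Proof.
move=> pp I X S inj Sc; have kp := perf_kproj pp.
have [[t tP] _] := Sc (bsum X) (fun i => dmap (binj X i)).
have [[t' t'P] _] := bsum_coproduct inj.
have t't : t' \oD t =D did S.
  have [_ uniqS] := Sc S inj; apply: uniqS => i.
  apply: deq_trans (deq_sym (deq_assoc _ _ _)) _.
  apply: deq_trans (deq_comp (deq_refl _) (tP i)) _.
  exact: deq_trans (t'P i) (deq_sym (deq_idl _)).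
have qi := @quasi_iso_id R p.
split=> [g|s f us sf i is_].
  have [b gb] := act_exists kp g (cm_id p).
  have [u bu] := act_exists kp t b.
  have [b0 ub0] := act_exists kp t' u.
  have bb0 : nullh (b0 - b).
    have : act (t' \oD t) b b0 by exists u.
    by move/(act_deq kp _ _ t't); rewrite /= cm_comp1l.
  (* A finite truncation of u is homotopic to u; its components, sent back by t', add up to a
     representative of g. *)
  have [s0 su] := perf_hcompact pp u; pose s := undup s0.
  have us : uniq s := undup_uniq s0.
  have {}su : nullh (keep X s \oC u - u).
    by apply: keep_mono su => i; rewrite mem_undup.
  exists s, (fun i => dmap (bproj X i \oC u)); split=> //.
  have ex i := act_exists kp t' (binj X i \oC (bproj X i \oC u)).
  pose d i := sval (cid (ex i)).
  have dP i : act t' (binj X i \oC (bproj X i \oC u)) (d i) := svalP (cid (ex i)).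
  apply: (deq_act qi (b := b) gb).
  have H : nullh (\sum_(i <- s) d i - b).
    apply: nullhBT bb0; apply: (act_uniq kp (act_sum s dP) ub0).
    have -> : \sum_(i <- s) binj X i \oC (bproj X i \oC u) = keep X s \oC u; last by [].
    rewrite keep_sum //; elim/big_rec2: _ => [|i v w _ ->]; first by rewrite cm_comp0l.
    by rewrite cm_compDl cm_compA.
  apply: (act_homotopic (nullhBB (cm_id p)) H); apply: act_dbigsum => i.
  exists (bproj X i \oC u); split; first by rewrite /= cm_comp1r.
  apply: (iffLR (act_deq kp _ _ (t'P i))).
  by exists (binj X i \oC (bproj X i \oC u)); split=> //; apply: nullhBB.
pose b i := sval (cid (act_exists kp (f i) (cm_id p))).
have bP i : act (f i) (cm_id p) (b i) := svalP (cid (act_exists kp (f i) (cm_id p))).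
pose d i := sval (cid (act_exists kp (inj i) (b i))).
have dP i : act (inj i) (b i) (d i) := svalP (cid (act_exists kp (inj i) (b i))).
pose e i := sval (cid (act_exists kp t (d i))).
have eP i : act t (d i) (e i) := svalP (cid (act_exists kp t (d i))).
have d0 : nullh (\sum_(j <- s) d j).
  have : act (dbigsum s (fun j => inj j \oD f j)) (cm_id p) (\sum_(j <- s) d j).
    by apply: act_dbigsum => j; exists (b j).
  move/(act_deq kp _ _ sf)/(act_uniq kp)/(_ (act_dzero _ _) (nullhBB _)).
  by rewrite subr0.
have /act_uniq0-/(_ kp d0) e0 := act_sum s eP.
have be j : nullh (e j - binj X j \oC b j).
  apply: (act_uniq kp _ (act_dmap_comp (binj X j) (b j)) (nullhBB (b j))).
  by apply: (iffLR (act_deq kp _ _ (tP j))); exists (d j).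
(* In the explicit sum, projecting to the summand i kills every term but the i-th, which leaves b
   i. *)
have : nullh (bproj X i \oC \sum_(j <- s) e j) by apply: nullh_compl.
rewrite (big_rem i) //= cm_compDr => ei.
have pe j : nullh (bproj X i \oC e j - (bproj X i \oC binj X j) \oC b j).
  by rewrite -cm_compA -cm_compBr; apply: nullh_compl.
have e'0 : nullh (bproj X i \oC \sum_(y <- rem i s) e y).
  rewrite big_seq; elim/big_ind: _ => [|u v nu nv|j].
  - by rewrite cm_comp0r; apply: nullh0.
  - by rewrite cm_compDr; apply: nullhD.
  rewrite mem_rem_uniq // inE => /andP[ji _].
  by have := pe j; rewrite bproj0 // cm_comp0l subr0.
have bi : nullh (b i - 0).
  have := nullhB (nullhB ei e'0) (pe i).
  by rewrite addrK bprojK cm_comp1l subKr subr0.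
exact: deq_act qi (act_homotopic (nullhBB _) bi (bP i)) (act_dzero _ _).
Qed.

(** A map from P to a direct sum is a finite sum of components in D(R). As P is K-projective, this
    already holds up to homotopy. *)
Lemma compact_hcompact c P (q : chain_map P c) :
  kproj P -> quasi_iso q -> compact c -> hcompact P.
Proof.
move=> kP qq cc J X g.
have [/(_ (dmap g \oD dinv qq))[s [f [us gE]]] _] :=
  cc _ X _ _ (bsum_coproduct (X := X)).
pose b j := sval (cid (act_exists kP (f j) q)).
have bP j : act (f j) q (b j) := svalP (cid (act_exists kP (f j) q)).
have gG : nullh (g - \sum_(j <- s) binj X j \oC b j).
  have /(act_deq kP _ _ gE) : act (dmap g \oD dinv qq) q g.
    by exists (cm_id P); rewrite /= !cm_comp1r.
  move/(act_uniq kP)/(_ _ (nullhBB _)); apply.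
  by apply: act_dbigsum => j; exists (b j); split=> [|/=].
exists s; set G := \sum_(j <- s) _ in gG.
have GE : keep X s \oC G = G.
  rewrite /G big_seq; elim/big_ind: _ => [|u v uE vE|j js].
  - exact: cm_comp0r.
  - by rewrite cm_compDr uE vE.
  - by rewrite cm_compA keep_inj.
apply: nullhBT (nullhBC gG); rewrite -[X in _ - X]GE -cm_compBr.
exact: nullh_compl.
Qed.

(** The resolution of c is homotopy-compact and built from R, so its identity factors through a
    perfect complex. *)
Lemma compact_retract c : compact c -> exists p, perf p /\
  exists (i : dhom c p) (r : dhom p c), r \oD i =D did c.
Proof.
have [P [q [lP qq]]] := resolution c; move=> /(compact_hcompact (loc_kproj lP) qq) hP.
have [p [pp [a [b ab]]]] := loc_finitary lP hP (cm_id P).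
exists p; split=> //; exists (dmap a \oD dinv qq), (dmap (q \oC b)).
apply: (deq_act qq (b := q)); last by rewrite /= cm_comp1l.
exists a; split; last first.
  rewrite /= -cm_compA -[X in nullh (X - _)]cm_comp1r -cm_compBr.
  exact: nullh_compl.
by exists (cm_id P); rewrite /= !cm_comp1r.
Qed.

End Coproducts.

(** * Extension of partial transformations into F *)

Section Zorn.
Variables (T : Type) (P : (T -> Prop) -> Prop) (A0 : T -> Prop).

Definition subp (A B : T -> Prop) := forall x, A x -> B x.

Hypothesis P0 : P A0.
Hypothesis Pchain : forall C : (T -> Prop) -> Prop, (exists A, C A) ->
  (forall A, C A -> P A) -> (forall A B, C A -> C B -> subp A B \/ subp B A) ->
  P (fun x => exists2 A, C A & A x).

Lemma subp_eq A B : subp A B -> subp B A -> A = B.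
Proof. by move=> AB BA; apply: funext => x; apply: propext; split=> [/AB|/BA]. Qed.

(* The lemma [Zorn_bigcup] of mathcomp-classical does not apply below: the
   predicates there live on a type too large for its universe.
   If every element of P had a strictly larger one, given by g, the tower of
   sets obtained from A0 by g and unions would be a chain without a last term
   (Bourbaki). *)
Lemma zorn : exists M, [/\ P M, subp A0 M & forall B, P B -> subp M B -> subp B M].
Proof.
have sxx A : subp A A by [].
have sT B A C : subp A B -> subp B C -> subp A C by move=> AB BC x /AB/BC.
apply: contrapT => noM.
have gE A : exists B, subp A B /\ (P A -> subp A0 A -> P B /\ ~ subp B A).
  have [PA|nPA] := pselect (P A /\ subp A0 A); last first.
    by exists A; split=> // ? ?; case: nPA.
  apply: contrapT => nB; apply: noM; exists A; split; try by case: PA.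
  move=> B PB AB; apply: contrapT => nBA; apply: nB.
  by exists B; split.
pose g A := sval (cid (gE A)).
have sg A : subp A (g A) by have [] := svalP (cid (gE A)).
have gP A : P A -> subp A0 A -> P (g A) /\ ~ subp (g A) A.
  by have [_] := svalP (cid (gE A)).
pose union (C : (T -> Prop) -> Prop) x := exists2 A, C A & A x.
have sU (C : (T -> Prop) -> Prop) A : C A -> subp A (union C).
  by move=> CA x Ax; exists A.
pose tower (A : T -> Prop) := forall Q : (T -> Prop) -> Prop, Q A0 ->
  (forall B, Q B -> Q (g B)) ->
  (forall C : (T -> Prop) -> Prop, (exists B, C B) -> (forall B, C B -> Q B) ->
     Q (union C)) -> Q A.
have tw0 : tower A0 by [].
have twS A : tower A -> tower (g A).
  by move=> tA Q Q0 QS QU; exact: QS (tA Q Q0 QS QU).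
have twU (C : (T -> Prop) -> Prop) : (exists B, C B) ->
    (forall B, C B -> tower B) -> tower (union C).
  by move=> C0 tC Q Q0 QS QU; apply: (QU) => // B CB; exact: (tC B CB Q Q0 QS QU).
have twind (Q : (T -> Prop) -> Prop) : Q A0 ->
    (forall B, tower B -> Q B -> Q (g B)) ->
    (forall C : (T -> Prop) -> Prop, (exists B, C B) -> (forall B, C B -> tower B) ->
       (forall B, C B -> Q B) -> Q (union C)) ->
    forall A, tower A -> Q A.
  move=> Q0 QS QU A tA; suff [] : tower A /\ Q A by [].
  apply: (tA (fun A => tower A /\ Q A)) => [|B [tB QB]|C C0 CQ]; first by split.
    by split; [apply: twS | apply: QS].
  by split; [apply: twU => // B /CQ[] | apply: QU => // B /CQ[]].
have tw_ge A : tower A -> subp A0 A.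
  elim/twind: A / => [|B _ A0B|C [B CB] _ CA]; first by [].
    by apply: sT A0B (sg B).
  exact: sT (CA B CB) (sU _ _ CB).
pose extreme A := forall B, tower B -> subp B A -> ~ subp A B -> subp (g B) A.
have ext_cmp A : tower A -> extreme A -> forall B, tower B -> subp B A \/ subp (g A) B.
  move=> tA eA B; elim/twind: B / => [|B tB [BA|AB]|C C0 tC CA].
  - by left; apply: tw_ge.
  - have [AB|nAB] := pselect (subp A B); last by left; apply: eA.
    by right; rewrite (subp_eq AB BA).
  - by right; apply: sT AB (sg B).
  - have [[B [CB AB]]|nC] := pselect (exists B, C B /\ subp (g A) B).
      by right; apply: sT AB (sU _ _ CB).
    left=> x [B CB Bx]; case: (CA B CB) => [/(_ x Bx)//|AB].
    by case: nC; exists B.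
have ext A : tower A -> extreme A.
  elim/twind: A / => [|A tA eA|C C0 tC eC] B tB BA nAB.
  - by case: nAB; apply: tw_ge.
  - have [BA'|//] := ext_cmp A tA eA B tB.
    have [AB|nAB'] := pselect (subp A B); first by rewrite (subp_eq AB BA').
    exact: sT (eA B tB BA' nAB') (sg A).
  - have [A [CA nA]] : exists A, C A /\ ~ subp A B.
      apply: contrapT => nA; apply: nAB => x [A CA Ax].
      by have [/(_ x Ax)//|nAB] := pselect (subp A B); case: nA; exists A.
    have [BA'|AB] := ext_cmp A (tC A CA) (eC A CA) B tB; last first.
      by case: nA; apply: sT (sg A) AB.
    exact: sT (eC A CA B tB BA' nA) (sU _ _ CA).
have tot A B : tower A -> tower B -> subp A B \/ subp B A.
  move=> tA tB; have [|AB] := ext_cmp A tA (ext A tA) B tB; first by right.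
  by left; apply: sT (sg A) AB.
have PT A : tower A -> P A.
  elim/twind: A / => [//|A tA PA|C C0 tC PC].
    by have [] := gP A PA (tw_ge A tA).
  by apply: Pchain => // A B /tC tA /tC; apply: tot.
have tM : tower (union tower) by apply: twU => //; exists A0.
have [_] := gP _ (PT _ tM) (tw_ge _ tM); apply.
exact: sU (twS _ tM).
Qed.

End Zorn.

Section Functor.
Variables (R : pzRingType) (k : fieldType) (F : cfunctor R k).
Hypotheses (Fadd : additive_functor F) (Fexact : exact_functor F).

Record pobj := Pobj { pcpx :> complex R; pperf : perf pcpx }.
Implicit Types (p q c d : pobj) (X Y : complex R).

Definition cobj p : compact_object R := CompactObject (perf_compact (pperf p)).
Definition Fo p : vectType k := F (cobj p).
Definition Fd p q (u : dhom p q) : 'Hom(Fo q, Fo p) :=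
  @fmap R k F (cobj p) (cobj q) u.
Definition Fm p q (u : chain_map p q) : 'Hom(Fo q, Fo p) := Fd (dmap u).

Lemma Fm_homotopic p q (u v : chain_map p q) : nullh (u - v) -> Fm u = Fm v.
Proof. by move=> uv; apply: (@fmap_eq R k F (cobj p) (cobj q)); apply: deq_nullh. Qed.

Lemma Fm_id p x : Fm (cm_id p) x = x.
Proof. by rewrite [Fm _](@fmap_id R k F (cobj p)) lfunE. Qed.

Lemma Fm_comp p q c (v : chain_map q c) (u : chain_map p q) x :
  Fm (v \oC u) x = Fm u (Fm v x).
Proof.
rewrite -comp_lfunE -[(_ \o _)%VF](@fmap_comp R k F (cobj p) (cobj q) (cobj c)).
congr (fun_of_lfun _ x); apply: (@fmap_eq R k F (cobj p) (cobj c)).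
exact: deq_map_comp.
Qed.

Lemma dadd_dmap X Y (u v : chain_map X Y) :
  dadd (dmap u) (dmap v) =D dmap (u + v).
Proof.
have n (w : chain_map X Y) : act (dmap w) (cm_id X) w by rewrite /= cm_comp1r.
exact (deq_act (@quasi_iso_id R X) (act_dadd (n u) (n v)) (n (u + v))).
Qed.

Lemma FmD p q (u v : chain_map p q) x : Fm (u + v) x = Fm u x + Fm v x.
Proof.
rewrite -add_lfunE -[Fm u + Fm v](@Fadd (cobj p) (cobj q)).
congr (fun_of_lfun _ x); apply: (@fmap_eq R k F (cobj p) (cobj q)).
exact/deq_sym/dadd_dmap.
Qed.

Lemma Fm0 p q x : Fm (0 : chain_map p q) x = 0.
Proof. by apply: (addIr (Fm 0 x)); rewrite -FmD !add0r. Qed.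

Lemma FmB p q (u v : chain_map p q) x : Fm (u - v) x = Fm u x - Fm v x.
Proof. by rewrite -[in RHS](subrK v u) [in RHS]FmD addrK. Qed.

Definition pshift n p := Pobj (perf_shift n (pperf p)).
Definition pdsum p q := Pobj (perf_dsum (pperf p) (pperf q)).
Definition pcone p q (f : chain_map p q) := Pobj (perf_cone f (pperf p) (pperf q)).
Definition pfib p q (f : chain_map p q) := Pobj (perf_fib f (pperf p) (pperf q)).

Lemma diso_did X : diso (did X).
Proof. by exists (did X); split; apply: deq_idl. Qed.

Lemma cone_distinguished X Y (f : chain_map X Y) :
  distinguished (dmap f) (dmap (cone_in f)) (dmap (cone_out f)).
Proof.
exists X, Y, f, (did X), (did Y), (did (cone f)).
split; split; try exact: diso_did.
- exact: deq_trans (deq_idl _) (deq_sym (deq_idr _)).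
- exact: deq_trans (deq_idl _) (deq_sym (deq_idr _)).
apply: deq_trans (deq_sym (deq_idr _)).
by rewrite /= cm_shift_id; apply: deq_idl.
Qed.

(** Exactness of F at p for the triangle fib f -> p -> q. *)
Lemma F_lift p q (f : chain_map p q) (y : Fo p) :
  @Fm (pfib f) p (fib_map f) y = 0 -> exists z, Fm f z = y.
Proof.
move=> fy; pose p' := pshift (-1) (pshift 1 p); pose q' := pshift (-1) (pshift 1 q).
pose us : chain_map p' p := unshift (addNr 1) p.
pose rs : chain_map p p' := reshift (addNr 1) p.
pose rq : chain_map q q' := reshift (addNr 1) q.
(* The value n = -1 turns the cone into the fibre. The third exactness statement then sits at
   p[1][-1], and [us], [rs], [rq] lead back to p and q. *)
have [_ /(_ (cobj p) (cobj q) (cobj (pcone f)) _ _ _ (cone_distinguished f) (-1))]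
  := Fexact.
move=> /(_ (perf_compact (pperf (pshift (-1) p)))
  (perf_compact (pperf (pshift (-1) q)))
  (perf_compact (pperf (pfib f)))
  (perf_compact (pperf p')) (perf_compact (pperf q')))[_ _ kE].
have : Fm us y \in lker (@Fm (pfib f) p' (cm_shift (-1) (cone_out f))).
  by rewrite memv_ker -Fm_comp fy.
rewrite [lker _]kE => /memv_imgP[z _ usy].
pose f' : chain_map p' q' := cm_shift (-1) (cm_shift 1 f).
have {}usy : Fm us y = Fm f' z := usy.
exists (Fm rq z); rewrite -Fm_comp.
have -> : rq \oC f = f' \oC rs by apply: reshift_nat.
rewrite Fm_comp -usy -Fm_comp.
by rewrite -[RHS]Fm_id; congr (Fm _ y); apply: reshiftK.
Qed.

(** * Extending partial transformations by Zorn's lemma *)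

Section Extension.
Variable Y : complex R.

Definition triple := {p : pobj & (chain_map p Y * Fo p)%type}.
Definition tr p (u : chain_map p Y) (y : Fo p) : triple := existT _ p (u, y).

(** G is the graph of an additive natural transformation from a subfunctor of Hom(-, Y), up to
    homotopy, to F; [good_fun] makes it single-valued. *)
Record good (G : triple -> Prop) : Prop := Good {
  good0 : forall p, G (tr (0 : chain_map p Y) 0);
  goodB : forall p (u v : chain_map p Y) y z, G (tr u y) -> G (tr v z) ->
    G (tr (u - v) (y - z));
  good_homotopic : forall p (u v : chain_map p Y) y,
    nullh (u - v) -> G (tr u y) -> G (tr v y);
  good_nat : forall p q (u : chain_map q Y) y (v : chain_map p q),
    G (tr u y) -> G (tr (u \oC v) (Fm v y));
  good_fun : forall p y, G (tr (0 : chain_map p Y) y) -> y = 0 }.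

Lemma goodD G p (u v : chain_map p Y) y z :
  good G -> G (tr u y) -> G (tr v z) -> G (tr (u + v) (y + z)).
Proof.
move=> gG uy vz; have := goodB gG uy (goodB gG (good0 gG p) vz).
by rewrite !sub0r !opprK.
Qed.

Lemma good_uniq G p (u v : chain_map p Y) y z :
  good G -> nullh (u - v) -> G (tr u y) -> G (tr v z) -> y = z.
Proof.
move=> gG uv uy vz; apply/eqP; rewrite -subr_eq0; apply/eqP.
apply: (good_fun gG); apply: good_homotopic (gG) _ _ _ _ _ (goodB gG uy vz).
by rewrite subr0.
Qed.

Lemma good_union (C : (triple -> Prop) -> Prop) : (exists G, C G) ->
  (forall G, C G -> good G) ->
  (forall G H, C G -> C H -> subp G H \/ subp H G) ->
  good (fun t => exists2 G, C G & G t).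
Proof.
move=> [G0 CG0] gC tC; split.
- by move=> p; exists G0 => //; apply: good0 (gC _ CG0) p.
- move=> p u v y z [G CG uy] [H CH vz].
  have [/(_ _ uy) uy'|/(_ _ vz) vz'] := tC _ _ CG CH.
    by exists H => //; apply: goodB => //; apply: gC.
  by exists G => //; apply: goodB => //; apply: gC.
- by move=> p u v y uv [G CG uy]; exists G => //; apply: (good_homotopic (gC _ CG) uv).
- by move=> p q u y v [G CG uy]; exists G => //; apply: good_nat => //; apply: gC.
- by move=> p y [G CG]; apply: good_fun; apply: gC.
Qed.

(* Each f : d -> c with u f in the domain of G imposes the affine condition
   F(f) y = w on y.  By exactness of F finitely many of these conditions always
   have a common solution; as F c has finite dimension, all of them do. *)
Lemma good_solution G c (u : chain_map c Y) : good G ->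
  exists y : Fo c, forall d (f : chain_map d c) w,
    G (tr (u \oC f) w) -> Fm f y = w.
Proof.
move=> gG.
have sol d (f : chain_map d c) w : G (tr (u \oC f) w) -> exists y, Fm f y = w.
  (* On the fibre of f the map u f becomes null-homotopic, so single-valuedness of G forces the
     restriction of w to vanish there. *)
  move=> fw; apply: F_lift; apply: (good_fun gG).
  have := good_nat gG (fib_map f : chain_map (pfib f) d) fw.
  apply: good_homotopic (gG) _ _ _ _ _.
  by rewrite subr0 -cm_compA; apply/nullh_compl/nullh_fib.
(* Among all conditions, one with solution space of least dimension is selected; its solutions turn
   out to satisfy every other one. *)
pose cond n := `[< exists d (f : chain_map d c) w,
   G (tr (u \oC f) w) /\ \dim (lker (Fm f)) = n >].
have exn : exists n, cond n.
  eexists; apply/asboolP; exists c, 0, 0; split; last by reflexivity.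
  by rewrite cm_comp0r; apply: good0.
have [n /asboolP[d [f [w [fw dn]]]] nmin] := ex_minnP exn.
have [y yw] := sol _ _ _ fw; exists y => d' f' w' fw'.
(* The map h from the sum combines both conditions. By minimality F(h) and F(f) have the same
   kernel, so y differs from the common solution z by an element that F(h), and hence F(f'),
   kills. *)
pose e := pdsum d d'.
pose fst' : chain_map e d := cm_fst d d'; pose snd' : chain_map e d' := cm_snd d d'.
pose inl' : chain_map d e := cm_inl d d'; pose inr' : chain_map d' e := cm_inr d d'.
have fl : fst' \oC inl' = cm_id d := cm_inlK d d'.
have sl : snd' \oC inl' = 0 := cm_snd_inl d d'.
have fr : fst' \oC inr' = 0 := cm_fst_inr d d'.
have sr : snd' \oC inr' = cm_id d' := cm_inrK d d'.
pose h : chain_map e c := f \oC fst' + f' \oC snd'.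
have hl : h \oC inl' = f.
  by rewrite cm_compDl -(cm_compA f) -(cm_compA f') fl sl cm_comp0r addr0 cm_comp1r.
have hr : h \oC inr' = f'.
  by rewrite cm_compDl -(cm_compA f) -(cm_compA f') fr sr cm_comp0r add0r cm_comp1r.
have hw : G (tr (u \oC h) (Fm fst' w + Fm snd' w')).
  rewrite cm_compDr (cm_compA _ f) (cm_compA _ f').
  by apply: (goodD gG); [apply: (good_nat gG _ fw) | apply: (good_nat gG _ fw')].
have [z zw] := sol _ _ _ hw.
have fz : Fm f z = w.
  rewrite -hl Fm_comp zw linearD /= -!Fm_comp.
  by rewrite fl sl Fm_id Fm0 addr0.
have fz' : Fm f' z = w'.
  rewrite -hr Fm_comp zw linearD /= -!Fm_comp.
  by rewrite fr sr Fm_id Fm0 add0r.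
have hf : (lker (Fm h) <= lker (Fm f))%VS.
  by apply/subvP => x; rewrite !memv_ker -hl Fm_comp => /eqP->; rewrite linear0.
have kE : lker (Fm h) = lker (Fm f).
  apply/eqP; rewrite eqEdim hf dn nmin //; apply/asboolP.
  by exists e, h, (Fm fst' w + Fm snd' w').
have : y - z \in lker (Fm h) by rewrite kE memv_ker linearB /= yw fz subrr.
rewrite memv_ker => /eqP yz; apply/eqP; rewrite -fz' -subr_eq0 -linearB /=.
by rewrite -hr Fm_comp yz linear0.
Qed.

Lemma good_total G : good G -> exists M, [/\ good M, subp G M &
  forall p (u : chain_map p Y), exists y, M (tr u y)].
Proof.
move=> gG; have [M [gM GM maxM]] := zorn gG good_union.
exists M; split=> // c m; have [y yM] := good_solution m gM.
(* The subfunctor generated by the domain of M and the new map m, with y as the prescribed value at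
   m. *)
pose N (t : triple) :=
  exists w0 (u0 : chain_map (projT1 t) Y) (f : chain_map (projT1 t) c),
  [/\ M (tr u0 w0), nullh ((projT2 t).1 - (u0 + m \oC f)) & (projT2 t).2 = w0 + Fm f y].
have NE p (u : chain_map p Y) w : N (tr u w) <-> exists w0 u0 (f : chain_map p c),
  [/\ M (tr u0 w0), nullh (u - (u0 + m \oC f)) & w = w0 + Fm f y] by [].
have gN : good N.
  split.
  - move=> p; apply/NE; exists 0, 0, 0; split; first exact: good0.
      by rewrite cm_comp0r addr0.
    by rewrite Fm0 addr0.
  - move=> p u v x z /NE[w0 [u0 [f [Mu uE ->]]]] /NE[w1 [u1 [g [Mv vE ->]]]].
    apply/NE; exists (w0 - w1), (u0 - u1), (f - g); split; first exact: goodB.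
      have aux (V : zmodType) (a b i j s t : V) :
          a - (i + s) - (b - (j + t)) = a - b - (i - j + (s - t)).
        rewrite [i - j + _]addrACA -opprD !opprB addrACA [RHS]addrACA.
        by rewrite [in RHS](addrC (- b)).
      by have := nullhB uE vE; rewrite aux cm_compBr.
    by rewrite FmB opprD addrACA.
  - move=> p u v x uv /NE[w0 [u0 [f [Mu uE ->]]]]; apply/NE.
    by exists w0, u0, f; split=> //; apply: nullhBT uE; apply: nullhBC.
  - move=> p q u x v /NE[w0 [u0 [f [Mu uE ->]]]]; apply/NE.
    exists (Fm v w0), (u0 \oC v), (f \oC v); split; first exact: good_nat.
      by rewrite cm_compA -cm_compDl -cm_compBl; apply: nullh_compr.
    by rewrite linearD Fm_comp.
  - move=> p z /NE[w0 [u0 [f [Mu uE ->]]]].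
    (* Single-valuedness: if u0 + m f is null-homotopic, then m f lies in the domain of M with value
       -w0, and the choice of y gives F(f) y = -w0. *)
    have : M (tr (m \oC f) (0 - w0)).
      apply: good_homotopic (gM) _ _ _ _ _ (goodB gM (good0 gM p) Mu).
      by move: uE; rewrite !sub0r opprD.
    by move/yM->; rewrite sub0r addrN.
have MN : subp M N.
  move=> [p [u w]] Mu; apply/NE; exists w, u, 0.
  by rewrite cm_comp0r addr0 Fm0 addr0.
exists y; apply: maxM gN MN _ _; apply/NE; exists 0, 0, (cm_id c).
by rewrite cm_comp1r !add0r Fm_id; split=> //; apply: good0.
Qed.

Record transf := Transf {
  tfun :> forall p, chain_map p Y -> Fo p;
  tfunD : forall p (u v : chain_map p Y), tfun (u + v) = tfun u + tfun v;
  tfun_homotopic : forall p (u v : chain_map p Y), nullh (u - v) -> tfun u = tfun v;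
  tfun_nat : forall p q (u : chain_map q Y) (v : chain_map p q),
    tfun (u \oC v) = Fm v (tfun u) }.

Lemma transf_extend G : good G ->
  exists t : transf, forall p (u : chain_map p Y) y, G (tr u y) -> t p u = y.
Proof.
move=> /good_total[M [gM GM totM]].
pose t p (u : chain_map p Y) := sval (cid (totM p u)).
have tP p u : M (tr u (@t p u)) := svalP (cid (totM p u)).
have tE p u y : M (tr u y) -> @t p u = y by apply: good_uniq => //.
unshelve eexists (@Transf t _ _ _) => /=.
- by move=> p u v; apply: tE; apply: goodD.
- by move=> p u v uv; apply: tE; apply: (good_homotopic gM (nullhBC uv)).
- by move=> p q u v; apply: tE; apply: good_nat.
- by move=> p u y /GM/tE.
Qed.

End Extension.

End Functor.

(** * The representing complex *)

Section Representation.
Variables (R : pzRingType) (k : fieldType) (F : cfunctor R k).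
Hypotheses (Fadd : additive_functor F) (Fexact : exact_functor F).
Implicit Types (p q c d : pobj R) (X Y : complex R).

Lemma transf0 Y (t : transf F Y) p : t p 0 = 0.
Proof. by apply: (addIr (t p 0)); rewrite -tfunD !add0r. Qed.

Lemma transf_nullh Y (t : transf F Y) p (u : chain_map p Y) : nullh u -> t p u = 0.
Proof. by move=> nu; rewrite (@tfun_homotopic _ _ _ _ t _ u 0) ?transf0 ?subr0. Qed.

Lemma transfB Y (t : transf F Y) p (u v : chain_map p Y) :
  t p (u - v) = t p u - t p v.
Proof. by rewrite -[in RHS](subrK v u) [in RHS]tfunD addrK. Qed.

Lemma transf_sum Y (t : transf F Y) p (I : Type) (r : seq I) (u : I -> chain_map p Y) :
  t p (\sum_(i <- r) u i) = \sum_(i <- r) t p (u i).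
Proof.
by elim/big_rec2: _ => [|i x v _ <-]; [exact: transf0 | rewrite tfunD].
Qed.

Definition transf_res X Y (f : chain_map X Y) (y : transf F Y) (x : transf F X) :=
  forall p (u : chain_map p X), y p (f \oC u) = x p u.

Definition transf_ker X Y (f : chain_map X Y) (y : transf F Y) :=
  forall p (u : chain_map p X), y p (f \oC u) = 0.

Lemma transf_yoneda q (w : Fo F q) : exists t : transf F q,
  forall p (u : chain_map p q), t p u = Fm F u w.
Proof.
unshelve eexists (@Transf _ _ F q (fun p u => Fm F u w) _ _ _) => //=.
- by move=> p u v; apply: FmD.
- by move=> p u v uv; rewrite (Fm_homotopic F uv).
- by move=> p c u v; apply: Fm_comp.
Qed.

Lemma keep_comp_sum p (J : eqType) (X : J -> complex R) (u : chain_map p (bsum X)) s :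
  uniq s -> nullh (keep X s \oC u - u) ->
  nullh (u - \sum_(j <- s) binj X j \oC (bproj X j \oC u)).
Proof.
move=> us /nullhBC; rewrite keep_sum //; congr (nullh (_ - _)).
elim/big_rec2: _ => [|j v w _ <-]; first exact: cm_comp0l.
by rewrite cm_compDl cm_compA.
Qed.

(** By compactness of p only finitely many components of u matter. The value does not depend on the
    finite set chosen, because the components outside any admissible set are null-homotopic. *)
Lemma transf_bsum (J : eqType) (X : J -> complex R) (x : forall j, transf F (X j)) :
  exists y : transf F (bsum X), forall j, transf_res (binj X j) y (x j).
Proof.
pose sp p (u : chain_map p (bsum X)) := undup (sval (cid (perf_hcompact (pperf p) u))).
have spU p u : uniq (@sp p u) by apply: undup_uniq.
have spP p u : nullh (keep X (@sp p u) \oC u - u).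
  by apply: keep_mono (svalP (cid (perf_hcompact (pperf p) u))) => j; rewrite mem_undup.
pose t p (u : chain_map p (bsum X)) := \sum_(j <- sp p u) x j p (bproj X j \oC u).
have off p (u : chain_map p (bsum X)) s j : nullh (keep X s \oC u - u) -> j \notin s ->
    x j p (bproj X j \oC u) = 0.
  move=> su js; apply: transf_nullh.
  have := nullh_compl (bproj X j) (nullhBC su); rewrite cm_compBr cm_compA.
  have -> : bproj X j \oC keep X s = 0; last by rewrite cm_comp0l subr0.
  by apply: chain_map_ext => i z; rewrite -[LHS]/(keep X s i z j) keep_modE (negPf js).
have tE p (u : chain_map p (bsum X)) s : uniq s -> nullh (keep X s \oC u - u) ->
    t p u = \sum_(j <- s) x j p (bproj X j \oC u).
  move=> us su; apply: big_supp => // j; first exact: off (spP p u).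
  exact: off su.
unshelve eexists (@Transf _ _ F (bsum X) t _ _ _) => /=.
- move=> p u v; pose s := undup (sp p u ++ sp p v).
  have us : uniq s by apply: undup_uniq.
  have su : nullh (keep X s \oC u - u).
    by apply: keep_mono (spP p u) => j ju; rewrite mem_undup mem_cat ju.
  have sv : nullh (keep X s \oC v - v).
    by apply: keep_mono (spP p v) => j jv; rewrite mem_undup mem_cat jv orbT.
  rewrite (tE _ u s) // (tE _ v s) // (tE _ (u + v) s) //; last first.
    by rewrite cm_compDr opprD addrACA; apply: nullhD.
  by rewrite -big_split; apply: eq_bigr => j _; rewrite cm_compDr tfunD.
- move=> p u v uv; rewrite (tE _ v (sp p u)) //; last first.
    apply: (nullhBT (nullhBT _ (spP p u)) uv).
    by rewrite -cm_compBr; apply/nullh_compl/nullhBC.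
  apply: eq_bigr => j _; apply: tfun_homotopic.
  by rewrite -cm_compBr; apply: nullh_compl.
- move=> p q u v; rewrite (tE _ (u \oC v) (sp q u)) //; last first.
    by rewrite cm_compA -cm_compBl; apply/nullh_compr/spP.
  by rewrite linear_sum; apply: eq_bigr => j _; rewrite cm_compA tfun_nat.
move=> j p u /=; rewrite (tE _ _ [:: j]) //.
  by rewrite big_seq1 cm_compA bprojK cm_comp1l.
by rewrite cm_compA keep_inj ?mem_head.
Qed.

Lemma transf_cone X Y (f : chain_map X Y) (y : transf F Y) : transf_ker f y ->
  exists x : transf F (cone f), transf_res (cone_in f) x y.
Proof.
move=> fy.
(* The transformation induced on the image of Hom(-, Y) in Hom(-, cone f). It is well defined
   because a map that dies in the cone factors through f, where y vanishes. *)
pose G (t : triple F (cone f)) := exists v : chain_map (projT1 t) Y,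
  nullh ((projT2 t).1 - cone_in f \oC v) /\ (projT2 t).2 = y _ v.
have GE p (u : chain_map p (cone f)) w : G (tr u w) <->
  exists v : chain_map p Y, nullh (u - cone_in f \oC v) /\ w = y p v by [].
have gG : good G.
  split.
  - by move=> p; apply/GE; exists 0; rewrite cm_comp0r transf0.
  - move=> p u v a b /GE[u' [uu ->]] /GE[v' [vv ->]]; apply/GE; exists (u' - v').
    by rewrite transfB cm_compBr opprD addrACA -opprD; split=> //; apply: nullhB.
  - move=> p u v a uv /GE[u' [uu ->]]; apply/GE; exists u'; split=> //.
    exact: nullhBT (nullhBC uv) uu.
  - move=> p q u a v /GE[u' [uu ->]]; apply/GE; exists (u' \oC v).
    by rewrite tfun_nat cm_compA -cm_compBl; split=> //; apply: nullh_compr.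
  - move=> p a /GE[v [/nullhBC]]; rewrite subr0 => /cone_in_ker[v' vv] ->.
    by rewrite (tfun_homotopic y vv) fy.
have [x xG] := transf_extend Fadd Fexact gG.
by exists x => p u; apply: xG; apply/GE; exists u.
Qed.

Definition pobj_code (t : pcode R) : pobj R := Pobj (ex_intro _ t erefl).

(** The generators are the Yoneda transformations of all elements of F. Restricting x to one and
    evaluating at the identity gives surjectivity; the attached cells give injectivity. *)
Lemma transf_representable : exists X (x : transf F X), forall p,
  (forall w : Fo F p, exists u : chain_map p X, x p u = w) /\
  (forall u : chain_map p X, x p u = 0 -> nullh u).
Proof.
pose gen (t : pcode R) (w : Fo F (pobj_code t)) := sval (cid (transf_yoneda w)).
have genE (t : pcode R) (w : Fo F (pobj_code t)) p (u : chain_map p (pobj_code t)) :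
  gen t w p u = Fm F u w := svalP (cid (transf_yoneda w)) p u.
have [||||||||X [x [_ xS xI]]] := @brown R (transf F) transf_res transf_ker
  _ _ _ _ _ _ _ (pcode R) (@pcx R) _ gen.
- exact: transf_bsum.
- exact: transf_cone.
- move=> J X Y f y fy p u.
  have [s su] := perf_hcompact (pperf p) u; pose s' := undup s.
  have /(nullh_compl f) : nullh (u - \sum_(j <- s') binj X j \oC (bproj X j \oC u)).
    apply: keep_comp_sum; first exact: undup_uniq.
    by apply: keep_mono su => j; rewrite mem_undup.
  rewrite cm_compBr => /(tfun_homotopic y) ->.
  have -> : f \oC (\sum_(j <- s') binj X j \oC (bproj X j \oC u)) =
    \sum_(j <- s') f \oC binj X j \oC (bproj X j \oC u).
    by elim/big_rec2: _ => [|j v w _ <-]; rewrite ?cm_comp0r // cm_compDr cm_compA.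
  by rewrite transf_sum big1 // => j _; apply: fy.
- by move=> A Y f g y a fa ga p u; rewrite cm_compBl transfB fa ga subrr.
- by move=> A B Y f g y b a fb ga p u; rewrite -cm_compA fb ga.
- by move=> A B Y f g y b fb fg p u; rewrite -fb cm_compA fg.
- move=> A Y f g y fg fy p u; rewrite -(fy p u); apply/esym/tfun_homotopic.
  by rewrite -cm_compBl; apply: nullh_compr.
- by move=> t; apply: perf_hcompact; exists t.
exists X, x => -[p [t tp]]; case: _ / tp => {p}; split=> [w|u u0].
  have [f fw] := xS t w; exists f.
  have := fw (pobj_code t) (cm_id _); rewrite cm_comp1r => ->.
  by rewrite genE Fm_id.
(* By naturality, vanishing of x at u alone gives vanishing at all u v, that is, along u. *)
apply: xI => p v; have := @tfun_nat _ _ _ _ x p (pobj_code t) u v.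
by move=> ->; rewrite [x _ _]u0 linear0.
Qed.

End Representation.

Theorem lemma2p14 (R : pzRingType) (k : fieldType)
    (hcoh : coherent R)
    (hpd : forall M : rmod R, fin_presented M -> fin_proj_dim M)
    (L : klinear R k) (F : cfunctor R k)
    (hlin : klinear_functor L F) (hex : exact_functor F) :
  exists X : complex R, iso_yoneda L F X.
Proof.
have [Fadd Fscale] := hlin; have [X [x xP]] := transf_representable Fadd hex.
exists X.
(* On perfect p a morphism to X in D(R) is represented by a chain map unique up to homotopy, at
   which x is evaluated. *)
pose xd (p : pobj R) (g : dhom p X) : Fo F p :=
  x p (sval (cid (act_exists (perf_kproj (pperf p)) g (cm_id p)))).
have xdE (p : pobj R) (g : dhom p X) u : act g (cm_id p) u -> xd p g = x p u.
  move=> gu; rewrite /xd; case: cid => v /= gv; apply: tfun_homotopic.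
  exact: (act_uniq (perf_kproj (pperf p)) gv gu (nullhBB _)).
have ex (p : pobj R) (g : dhom p X) : exists u, act g (cm_id p) u.
  exact: (act_exists (perf_kproj (pperf p)) g (cm_id p)).
have xd_eq (p : pobj R) (g h : dhom p X) : g =D h -> xd p g = xd p h.
  move=> gh; have [u gu] := ex p g; rewrite (xdE _ _ _ gu) (xdE p h u) //.
  exact: iffLR (act_deq (perf_kproj (pperf p)) _ _ gh) gu.
have xd_inj (p : pobj R) (g h : dhom p X) : xd p g = xd p h -> g =D h.
  have [u gu] := ex p g; have [v hv] := ex p h.
  rewrite (xdE _ _ _ gu) (xdE _ _ _ hv) => /eqP; rewrite -subr_eq0 -transfB => /eqP uv.
  have {}uv := (xP p).2 _ uv.
  apply: (deq_act (@quasi_iso_id R p) gu).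
  exact: act_homotopic (nullhBB _) (nullhBC uv) hv.
have xd_nat (p q : pobj R) (g : dhom q X) (h : dhom p q) :
    xd p (g \oD h) = Fd F h (xd q g).
  have [v hv] := dmap_full (perf_kproj (pperf p)) h; have [u gu] := ex q g.
  rewrite (xdE _ _ _ gu) (xd_eq _ _ _ (deq_comp (deq_refl g) hv)).
  rewrite (xdE _ _ (u \oC v)); last first.
    exists v; split; first by rewrite /= cm_comp1r.
    by have := act_precomp v gu; rewrite cm_comp1l.
  rewrite tfun_nat; congr (fun_of_lfun _ _).
  exact/esym/(@fmap_eq R k F (cobj p) (cobj q)).
pose ret (c : compact_object R) := cid (compact_retract (cvalP c)).
pose P (c : compact_object R) : pobj R := Pobj (svalP (ret c)).1.
pose i (c : compact_object R) : dhom c (P c) := sval (cid (svalP (ret c)).2).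
pose r (c : compact_object R) : dhom (P c) c :=
  sval (cid (svalP (cid (svalP (ret c)).2))).
have ri (c : compact_object R) : r c \oD i c =D did c :=
  svalP (cid (svalP (cid (svalP (ret c)).2))).
pose Fi (c : compact_object R) : 'Hom(Fo F (P c), F c) :=
  @fmap R k F c (cobj (P c)) (i c).
pose Fr (c : compact_object R) : 'Hom(F c, Fo F (P c)) :=
  @fmap R k F (cobj (P c)) c (r c).
have FiFr c y : Fi c (Fr c y) = y.
  rewrite -comp_lfunE -[(_ \o _)%VF](@fmap_comp R k F c (cobj (P c)) c).
  by rewrite (@fmap_eq R k F c c _ _ (ri c)) fmap_id lfunE.
have FrFi c y : Fr c (Fi c y) = Fd F (i c \oD r c) y.
  by rewrite -comp_lfunE -[(_ \o _)%VF](@fmap_comp R k F (cobj (P c)) c (cobj (P c))).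
have rir (c : compact_object R) Y (f : dhom c Y) :
    f \oD r c \oD (i c \oD r c) =D f \oD r c.
  apply: deq_trans (deq_sym (deq_assoc _ _ _)) _; apply: deq_comp (deq_refl f) _.
  apply: deq_trans (deq_assoc _ _ _) _.
  exact: deq_trans (deq_comp (ri c) (deq_refl _)) (deq_idl _).
have firi (c : compact_object R) Y (f : dhom c Y) : f \oD r c \oD i c =D f.
  apply: deq_trans (deq_sym (deq_assoc _ _ _)) _.
  exact: deq_trans (deq_comp (deq_refl f) (ri c)) (deq_idr _).
(* For compact c both D(R)(c, X) and F(c) are retracts of their values at the perfect complex [P c];
   [eta] is the isomorphism there, compressed by i and r. *)
pose eta (c : compact_object R) (f : dhom c X) : F c := Fi c (xd (P c) (f \oD r c)).
have Fr_eta (c : compact_object R) f : Fr c (eta c f) = xd (P c) (f \oD r c).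
  by rewrite FrFi -xd_nat; apply/xd_eq/rir.
have eta_eq (c : compact_object R) (f g : dhom c X) : f =D g -> eta c f = eta c g.
  by move=> fg; congr (Fi c _); apply/xd_eq/deq_comp/deq_refl.
have eta_nat (c d : compact_object R) (h : dhom c d) (f : dhom d X) :
    eta c (f \oD h) = fmap F h (eta d f).
  have FiFh y : fmap F h y = Fi c (Fd F (i d \oD h \oD r c) (Fr d y)).
    rewrite -!comp_lfunE; congr (fun_of_lfun _ y).
    rewrite -[(Fi c \o _)%VF](@fmap_comp R k F c (cobj (P c)) (cobj (P d))).
    rewrite -[RHS](@fmap_comp R k F c (cobj (P d)) d); apply: fmap_eq.
    apply: deq_sym; apply: deq_trans (deq_comp (deq_refl _) (firi _ _ _)) _.
    apply: deq_trans (deq_assoc _ _ _) _.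
    exact: deq_trans (deq_comp (ri d) (deq_refl h)) (deq_idl h).
  rewrite FiFh Fr_eta -xd_nat; congr (Fi c _); apply: xd_eq; apply: deq_sym.
  apply: deq_trans (deq_assoc _ _ _) _; apply: deq_comp (deq_refl _).
  apply: deq_trans (deq_assoc _ _ _) _; exact: deq_comp (firi d _ f) (deq_refl h).
exists eta; split.
- move=> c f g; split; first exact: eta_eq.
  (* Applying F(r) recovers the value at f r, which determines f r and hence f = f r i. *)
  move/(congr1 (Fr c)); rewrite !Fr_eta => /xd_inj fg.
  apply: deq_trans (deq_sym (firi c _ f)) (deq_trans _ (firi c _ g)).
  exact: deq_comp fg (deq_refl _).
- move=> c y; have [u uy] := (xP (P c)).1 (Fr c y).
  exists (dmap u \oD i c); rewrite -[RHS]FiFr -uy.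
  rewrite /eta (xd_eq _ _ _ (deq_sym (deq_assoc _ _ _))) xd_nat -FrFi FiFr.
  congr (Fi c _); apply: xdE; by rewrite /= cm_comp1r.
- move=> c f g; rewrite /eta -linearD; congr (Fi c _).
  have kP := perf_kproj (pperf (P c)).
  have [a ra] := act_exists kP (r c) (cm_id _).
  have [u fu] := act_exists kP f a; have [v gv] := act_exists kP g a.
  rewrite (xdE _ (f \oD r c) _ (act_comp ra fu)) (xdE _ (g \oD r c) _ (act_comp ra gv)).
  by rewrite (xdE _ _ _ (act_comp ra (act_dadd fu gv))) tfunD.
- move=> c a f.
  (* The transformations were only additive; k-linearity follows from naturality, since a f is f
     composed with a times the identity and F is k-linear. *)
  have -> : eta c (dscale L a f) = eta c (f \oD dscale L a (did c)).
    apply/eta_eq/deq_sym; apply: deq_trans (dscale_compr L _ _ _) _.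
    exact/dscale_eq/deq_idr.
  by rewrite eta_nat Fscale scale_lfunE fmap_id lfunE.
- by move=> c d h f; apply: eta_nat.
Qed.
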